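(* For each $n$ let $\{|\psi_i\rangle\}$ be an $\varepsilon$-approximate state $2$-design on $n$ qubits, where $\varepsilon=\varepsilon(n)=2^{-\Omega(n)}$. Let $d=d(n)$ and $k=k(n)$ satisfy $k\le 2^{-d}\cdot o(n/\log n)$. Then $\{|\psi_i\rangle\}$ is a pseudorandom state ensemble (PRS) against $\mathsf{QNC}$ circuits with depth $d$ and $k$ bits of output. That is, for every $t=\mathrm{poly}(n)$ and every (family of) $\mathsf{QNC}$ circuit(s) $C$ of depth at most $d$ acting on $tn$ input qubits, with $k$ output qubits that are measured in the computational basis, $$\left|\mathbb{E}_i\left[C\left(|\psi_i\rangle\langle\psi_i|^{\otimes t}\right)\right]-\mathbb{E}\left[C\left(|\psi_{\mathsf{Haar}}\rangle\langle\psi_{\mathsf{Haar}}|^{\otimes t}\right)\right]\right|_1=\mathrm{negl}(n).$$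
   Context: All objects are families indexed by $n$; $\mathrm{poly}(n)=n^{O(1)}$, $\mathrm{negl}(n)=n^{-\omega(1)}$; logarithms are base 2. A state ensemble $\{|\psi_i\rangle\}$ is a discrete probability distribution over $n$-qubit pure states and $\mathbb{E}_i$ is expectation over it. $|\psi_{\mathsf{Haar}}\rangle$ is an $n$-qubit Haar random state. The ensemble is an $\varepsilon$-approximate $2$-design if $\left\|\mathbb{E}_i[|\psi_i\rangle\langle\psi_i|^{\otimes 2}]-\mathbb{E}[|\psi_{\mathsf{Haar}}\rangle\langle\psi_{\mathsf{Haar}}|^{\otimes 2}]\right\|_1\le\varepsilon$ (trace norm). $\mathsf{QNC}$ circuits are polynomial-size quantum circuits whose gates act on at most $2$ qubits. Besides the input qubits they may use arbitrarily many (polynomially many) ancilla qubits, which start in any specified state independent of the input and may end in arbitrary states. $C(\rho)$ denotes the probability distribution of the measured output bits on input state $\rho$ (expectations of such distributions are mixtures), and $|\mathcal D-\mathcal D'|_1$ is the total variation distance between distributions. *)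

(* Defs.v *)
From HB Require Import structures.
From mathcomp Require Import all_boot all_order all_algebra.
From mathcomp Require Import complex.
From mathcomp Require Import all_classical all_reals all_analysis.

Set Implicit Arguments.
Unset Strict Implicit.
Unset Printing Implicit Defensive.

Import Order.TTheory GRing.Theory Num.Theory.
Import numFieldNormedType.Exports.
Local Open Scope classical_set_scope.
Local Open Scope ring_scope.
Local Open Scope complex_scope.
Local Open Scope sesquilinear_scope.

HB.instance Definition _ (R : realType) := isPointed.Build R[i] 0.

(* A system of qubits is indexed by an arbitrary finite type Q of labels: its  *)
(* computational basis is the type of assignments Q -> bool, which indexes     *)
(* matrices through enum_rank / enum_val. Thus n qubits are labelled by 'I_n,  *)
(* t copies of them by 'I_t * 'I_n (copy, position), and joint systems by      *)
(* disjoint unions of labels.                                                  *)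
Section Systems.
Variable R : realType.
Local Notation C := R[i].

Definition bits (Q : finType) := {ffun Q -> bool}.

Local Notation ket Q := 'cV[C]_#|{: bits Q}|.
Local Notation op Q := 'M[C]_#|{: bits Q}|.

Definition coef (Q : finType) (A : op Q) (x y : bits Q) : C :=
  A (enum_rank x) (enum_rank y).

Definition mkop (Q : finType) (f : bits Q -> bits Q -> C) : op Q :=
  \matrix_(i, j) f (enum_val i) (enum_val j).

Definition pure (Q : finType) (psi : ket Q) : Prop := psi^t* *m psi = 1%:M.

Definition projector (Q : finType) (psi : ket Q) : op Q := psi *m psi^t*.

(* Positivity over the complex numbers includes being Hermitian: [0 <= z] in   *)
(* R[i] says that z is real and nonnegative.                                   *)
Definition density (Q : finType) (rho : op Q) : Prop :=
  (forall v : ket Q, 0 <= (v^t* *m rho *m v) 0 0) /\ \tr rho = 1.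

Definition tensor (Q1 Q2 : finType) (A : op Q1) (B : op Q2) : op (Q1 + Q2)%type :=
  mkop (fun x y => coef A [ffun q => x (inl q)] [ffun q => y (inl q)] *
                   coef B [ffun q => x (inr q)] [ffun q => y (inr q)]).

Definition copies (t : nat) (Q : finType) (A : op Q) : op ('I_t * Q)%type :=
  mkop (fun x y => \prod_(j < t) coef A [ffun q => x (j, q)] [ffun q => y (j, q)]).

(* The sum of the singular values of A. *)
Definition trace_norm (N : nat) (A : 'M[C]_N) : R :=
  \sum_(i < N) complex.Re (sqrtC (spectral_diag (A^t* *m A) 0 i)).

(* The Borel sigma-algebra of kets, generated by the real and imaginary parts  *)
(* of the amplitudes.                                                          *)
Definition ket_generators (Q : finType) : set (set (ket Q)) :=
  [set A | exists i (B : set R), measurable B /\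
     (A = (fun v : ket Q => complex.Re (v i 0)) @^-1` B \/
      A = (fun v : ket Q => complex.Im (v i 0)) @^-1` B)].

Definition qstate (Q : finType) := g_sigma_algebraType (@ket_generators Q).

(* The law of a Haar random pure state: the (unique) unitarily invariant       *)
(* probability measure on the unit sphere.                                     *)
Definition is_haar (Q : finType) (mu : probability (qstate Q) R) : Prop :=
  mu [set v : qstate Q | pure v] = 1%E /\
  forall (U : op Q) (A : set (qstate Q)), U \is unitarymx -> measurable A ->
    mu ((fun v : qstate Q => U *m v) @^-1` A) = mu A.

(* A discrete probability distribution over pure states; nat is equipped with  *)
(* its discrete sigma-algebra, and finite ensembles are those whose            *)
(* distribution is supported on finitely many indices.                         *)
Record ensemble (Q : finType) := Ensemble {
  ens_law : probability nat R;
  ens_state : nat -> ket Q;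
  ens_pure : forall i, pure (ens_state i) }.
Arguments ens_state {Q} e i.

Definition cexpect d (T : measurableType d) (P : probability T R) (f : T -> C) : C :=
  (\int[P]_w complex.Re (f w)) +i* (\int[P]_w complex.Im (f w)).

Definition second_moment d (T : measurableType d) (P : probability T R)
    (Q : finType) (psi : T -> ket Q) : op ('I_2 * Q)%type :=
  \matrix_(i, j) cexpect P (fun w => copies 2 (projector (psi w)) i j).

Definition approx_2design (Q : finType) (haar : probability (qstate Q) R)
    (E : ensemble Q) (eps : R) : Prop :=
  trace_norm (second_moment (ens_law E) (ens_state E)
              - second_moment haar (fun v : qstate Q => v)) <= eps.

Record gate (Q : finType) := Gate {
  arity : nat;
  wires : 'I_arity -> Q;
  unitary : op 'I_arity;
  arity_le2 : (arity <= 2)%N;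
  wires_inj : injective wires;
  unitaryP : unitary \is unitarymx }.
Arguments wires {Q} g i.

Definition gate_op (Q : finType) (g : gate Q) : op Q :=
  mkop (fun x y => if [forall q, (q \in codom (wires g)) || (x q == y q)]
    then coef (unitary g) [ffun i => x (wires g i)] [ffun i => y (wires g i)]
    else 0).

Definition disjoint_gates (Q : finType) (g h : gate Q) : bool :=
  [disjoint codom (wires g) & codom (wires h)].

Local Notation register In a := (In + 'I_a)%type.

Record circuit (In : finType) (k : nat) := Circuit {
  ancillas : nat;
  ancilla_state : op 'I_ancillas;
  layers : seq (seq (gate (register In ancillas)));
  outputs : 'I_k -> (register In ancillas);
  ancilla_density : density ancilla_state;
  layers_disjoint : all (pairwise (@disjoint_gates _)) layers;
  outputs_inj : injective outputs }.
Arguments outputs {In k} c i.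

Definition circuit_depth (In : finType) k (c : circuit In k) : nat :=
  size (layers c).

Definition circuit_size (In : finType) k (c : circuit In k) : nat :=
  size (flatten (layers c)).

Definition final_state (In : finType) k (c : circuit In k) (rho : op In) :
    op (register In (ancillas c)) :=
  foldl (fun s g => gate_op g *m s *m (gate_op g)^t*)
    (tensor rho (ancilla_state c)) (flatten (layers c)).

(* The Born rule, the qubits that are not output being discarded. *)
Definition output (In : finType) k (c : circuit In k) (rho : op In) (z : bits 'I_k) : R :=
  \sum_(x : bits (register In (ancillas c)) | [ffun i => x (outputs c i)] == z)
    complex.Re (coef (final_state c rho) x x).

Definition expected_output d (T : measurableType d) (P : probability T R)
    (t : nat) (Q : finType) k (c : circuit ('I_t * Q)%type k) (psi : T -> ket Q)
    (z : bits 'I_k) : R :=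
  \int[P]_w output c (copies t (projector (psi w))) z.

Definition total_variation (k : nat) (p q : bits 'I_k -> R) : R :=
  2^-1 * \sum_z `|p z - q z|.

Definition poly_bounded (f : nat -> nat) : Prop :=
  exists c : nat, \forall n \near \oo, (f n <= n ^ c)%N.

Definition negligible_fun (f : nat -> R) : Prop :=
  forall c : nat, \forall n \near \oo, `|f n| <= n%:R ^- c.

(* f(n) = 2^(- Omega(n)) *)
Definition exp_small (f : nat -> R) : Prop :=
  exists2 c : R, 0 < c & \forall n \near \oo, f n <= 2 `^ (- (c * n%:R)).

Definition log2 (x : R) : R := ln x / ln 2.

Definition PRS_against_QNC
    (haar : forall n, probability (qstate 'I_n) R) (E : forall n, ensemble 'I_n)
    (d k : nat -> nat) : Prop :=
  forall (t : nat -> nat) (c : forall n, circuit ('I_(t n) * 'I_n)%type (k n)),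
    poly_bounded t ->
    poly_bounded (fun n => ancillas (c n)) ->
    poly_bounded (fun n => circuit_size (c n)) ->
    (forall n, (circuit_depth (c n) <= d n)%N) ->
    negligible_fun (fun n => total_variation
      (expected_output (ens_law (E n)) (c n) (ens_state (E n)))
      (expected_output (haar n) (c n) (fun v : qstate 'I_n => v))).

End Systems.

(* Main.v *)
Require Import Defs.
From mathcomp Require Import all_boot all_order all_algebra.
From mathcomp Require Import complex ring lra zify.
From mathcomp Require Import all_classical all_reals all_analysis measurable_realfun.

(* In the Heisenberg picture an output event is a projector supported on the   *)
(* light cone of the k output qubits, that is on m <= 2^d k = o(n) qubits. The *)
(* output probabilities thus only depend on the reduced states of the copies,  *)
(* through a sum of 2^O(m) products of their entries. For an approximate       *)
(* 2-design each such entry is, in mean square, 2^(-Omega(n))-close to that of *)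
(* the maximally mixed state: its variance is linear in the second moment, so  *)
(* by duality it is within eps of its Haar value, and the latter is O(2^-n)    *)
(* because the reflections leave the Haar measure invariant. Hence both output *)
(* distributions are within poly(n) 2^(O(m) - Omega(n)) of the output on       *)
(* maximally mixed copies.                                                     *)

(** Write m = 2^d k. By [circuit_cone], the probability of an outcome is the expectation of a
    projector local to at most m qubits. Tracing out the ancillas, [output_reduced] writes it as a
    sum of at most 4^m terms, each being a coefficient of modulus at most 2 * 2^m times a product,
    over the t copies, of entries of reduced states of psi. Replacing these entries by those of the
    maximally mixed state gives a reference value independent of psi; all factors having modulus at
    most 1, the errors in a product simply add up ([output_deviation]).

    Only the mean squares of the errors are controlled, hence the use of |z| <= s + |z|^2 / s with a
    free s > 0. The mean of |z|^2 pairs the second moment with a permutation matrix whose weights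
    have modulus at most 1 ([sqn_deviation]), so [trace_norm_duality] transfers the Haar bound 4 /
    2^n of [haar_deviation] to the ensemble at the cost of eps ([ensemble_deviation]). The Haar
    bound itself is obtained without computing the moments exactly: reflections exchange
    coordinates, flip signs, and compare E |v_x|^4 with E |v_x|^2 |v_y|^2.

    Summing over the 2^k outcomes, [total_variation_le] bounds the distance by 2^k * 2 * 2^m * 4^m *
    t * (s + eta / s) with eta = 4 / 2^n + eps. Since m = o(n) and eta is exponentially small, an s
    of the order of the square root of an exponential bound on eta makes this negligible. *)

Import Order.TTheory GRing.Theory Num.Theory.
Import numFieldNormedType.Exports.
Local Open Scope ring_scope.
Local Open Scope sesquilinear_scope.

Set Implicit Arguments.
Unset Strict Implicit.
Unset Printing Implicit Defensive.

(** * Bit strings and local operators *)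

Arguments wires {R Q} g i.

Section Masks.
Variable Q : finType.
Implicit Types (x y m u v : bits Q) (S T : {set Q}).

Definition bzero : bits Q := [ffun=> false].
Definition badd x y : bits Q := [ffun q => x q (+) y q].
Definition bcut S x : bits Q := [ffun q => (q \in S) && x q].

Lemma baddE x y q : badd x y q = x q (+) y q. Proof. exact: ffunE. Qed.
Lemma bcutE S x q : bcut S x q = (q \in S) && x q. Proof. exact: ffunE. Qed.

Lemma baddC x y : badd x y = badd y x.
Proof. by apply/ffunP=> q; rewrite !baddE addbC. Qed.

Lemma baddA x y m : badd x (badd y m) = badd (badd x y) m.
Proof. by apply/ffunP=> q; rewrite !baddE addbA. Qed.

Lemma badd0 x : badd x bzero = x.
Proof. by apply/ffunP=> q; rewrite baddE ffunE addbF. Qed.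

Lemma baddbb x : badd x x = bzero.
Proof. by apply/ffunP=> q; rewrite baddE ffunE addbb. Qed.

Lemma baddK m x : badd (badd x m) m = x.
Proof. by rewrite -baddA baddbb badd0. Qed.

Lemma badd_inj m : injective (badd^~ m).
Proof. by move=> x y /(congr1 (badd^~ m)); rewrite !baddK. Qed.

Lemma badd_eqr x m : (badd x m == x) = (m == bzero).
Proof.
apply/eqP/eqP => [E|->]; last exact: badd0.
by rewrite -(baddK x m) (baddC m) E baddbb.
Qed.

Lemma bcut_badd S x y : bcut S (badd x y) = badd (bcut S x) (bcut S y).
Proof. by apply/ffunP=> q; rewrite !(baddE, bcutE); case: (q \in S). Qed.

Lemma bcut_id S x : bcut S (bcut S x) = bcut S x.
Proof. by apply/ffunP=> q; rewrite !bcutE andbA andbb. Qed.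

Lemma badd_bcutC S x : badd x (bcut (~: S) x) = bcut S x.
Proof. by apply/ffunP=> q; rewrite !(baddE, bcutE) inE; case: (q \in S); case: (x q). Qed.

Lemma bcutC_eq0 S x : (bcut (~: S) x == bzero) = (bcut S x == x).
Proof.
by rewrite -(badd_bcutC S x) badd_eqr.
Qed.

Lemma bcut_disjoint S T x : [disjoint S & T] -> bcut S (bcut T x) = bzero.
Proof.
move=> dST; apply/ffunP=> q; rewrite !(bcutE, ffunE).
by case: (boolP (q \in S)) => //= /(disjointFr dST) ->.
Qed.

Lemma bcut_subl S T x : S \subset T -> bcut S (bcut T x) = bcut S x.
Proof.
move=> /fintype.subsetP sST; apply/ffunP=> q; rewrite !bcutE.
by case: (boolP (q \in S)) => [/sST->|].
Qed.

Lemma bcut0 S : bcut S bzero = bzero.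
Proof. by apply/ffunP=> q; rewrite bcutE !ffunE andbF. Qed.

Lemma card_bcut S : #|[pred x | bcut S x == x]| = (2 ^ #|S|)%N.
Proof.
rewrite -card_bool -(card_pffun_on false); apply: eq_card => x; rewrite inE.
apply/eqP/pffun_onP => [<-|[/supportP sx _]].
  split; last by [].
  by apply/supportP => q /negbTE qS; rewrite bcutE qS.
apply/ffunP=> q; rewrite bcutE; case: (boolP (q \in S)) => //= qS.
by rewrite sx.
Qed.

Lemma card_bits : #|{: bits Q}| = (2 ^ #|Q|)%N.
Proof. by rewrite card_ffun card_bool. Qed.

End Masks.
Arguments bzero {Q}.

Section Operators.
Variable R : realType.
Local Notation C := R[i].
Local Notation op Q := 'M[C]_#|{: bits Q}|.

Lemma unitary_conj_proj n (U A : 'M[C]_n) : U \is unitarymx -> A^t* = A -> A *m A = A ->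
  (U^t* *m A *m U)^t* = U^t* *m A *m U /\
  U^t* *m A *m U *m (U^t* *m A *m U) = U^t* *m A *m U.
Proof.
move=> /unitarymxP UU Ah Ap; split.
  by rewrite !trmx_mul !map_mxM trmxCK Ah mulmxA.
by rewrite !mulmxA -[_ *m U *m _]mulmxA UU mulmx1 -[_ *m A *m A]mulmxA Ap.
Qed.

Section OneSystem.
Variable Q : finType.
Implicit Types (A B G : op Q) (x y z m : bits Q) (S T : {set Q}).

Lemma coefP A B : (forall x y, coef A x y = coef B x y) -> A = B.
Proof.
move=> AB; apply/matrixP=> i j; have := AB (enum_val i) (enum_val j).
by rewrite /coef !enum_valK.
Qed.

Lemma coef_mkop (f : bits Q -> bits Q -> C) x y : coef (mkop f) x y = f x y.
Proof. by rewrite /coef mxE !enum_rankK. Qed.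

Lemma sum_enum_rank (V : nmodType) (F : 'I_#|{: bits Q}| -> V) :
  \sum_i F i = \sum_(x : bits Q) F (enum_rank x).
Proof. by rewrite (reindex _ (onW_bij _ (@enum_rank_bij _))). Qed.

Lemma coef_mul A B x y : coef (A *m B) x y = \sum_z coef A x z * coef B z y.
Proof. by rewrite /coef mxE sum_enum_rank. Qed.

Lemma coef_adj A x y : coef (A^t*) x y = (coef A y x)^*.
Proof. by rewrite /coef !mxE. Qed.

Lemma coef1 x y : coef (1%:M : op Q) x y = (x == y)%:R.
Proof. by rewrite /coef mxE (inj_eq enum_rank_inj). Qed.

Lemma mxtrace_coef A : \tr A = \sum_x coef A x x.
Proof. by rewrite /mxtrace sum_enum_rank. Qed.

(* A acts as the identity outside S; the additions are bitwise, so that the    *)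
(* first clause says that A preserves the bits outside S and the second that   *)
(* its entries do not depend on them.                                          *)
Definition local S A :=
  (forall x y, bcut (~: S) (badd x y) != bzero -> coef A x y = 0) /\
  (forall m x y, bcut S m = bzero -> coef A (badd x m) (badd y m) = coef A x y).

Lemma localS S T A : S \subset T -> local S A -> local T A.
Proof.
move=> sST [A0 Am]; split => [x y xy|m x y m0].
  apply: A0; apply: contra_neq xy => xy.
  have sTS : ~: T \subset ~: S by rewrite finset.setCS.
  by rewrite -(bcut_subl _ sTS) xy bcut0.
by apply: Am; rewrite -(bcut_subl _ sST) m0 bcut0.
Qed.

Lemma local_adj S A : local S A -> local S (A^t*).
Proof.
move=> [A0 Am]; split => [x y xy|m x y m0]; rewrite !coef_adj.
  by rewrite A0 ?conjC0 // baddC.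
by rewrite Am.
Qed.

Lemma local_mul S A B : local S A -> local S B -> local S (A *m B).
Proof.
move=> [A0 Am] [B0 Bm]; split => [x y xy|m x y m0]; rewrite !coef_mul.
  apply: big1 => z _; have [E|/A0->] := eqVneq (bcut (~: S) (badd x z)) bzero; last by rewrite mul0r.
  rewrite B0 ?mulr0 //; apply: contra_neq xy => E2.
  by rewrite -(baddK z x) -baddA bcut_badd E E2 badd0.
rewrite (reindex_inj (@badd_inj _ m)) /=; apply: eq_bigr => z _.
by rewrite Am // Bm.
Qed.

(* The operators act on x - z - y through the intermediate states z and        *)
(* x + z + y, the shift of x + z being invisible to A and that of z + y to B.  *)
Lemma local_comm S T A B :
  [disjoint S & T] -> local S A -> local T B -> A *m B = B *m A.
Proof.
move=> dST [A0 Am] [B0 Bm]; apply: coefP => x y; rewrite !coef_mul.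
pose h z := badd x (badd z y).
have hK : involutive h.
  by move=> z; rewrite /h (baddA x z y) baddK baddA baddbb baddC badd0.
rewrite (reindex_inj (inv_inj hK)) /=; apply: eq_bigr => z _.
have xh : badd x (h z) = badd z y by rewrite /h baddA baddbb baddC badd0.
have hy : badd (h z) y = badd x z by rewrite /h (baddA x z y) baddK.
have [Sz|Sz] := eqVneq (bcut (~: S) (badd z y)) bzero; last first.
  by rewrite !A0 ?xh // mul0r mulr0.
have [Tz|Tz] := eqVneq (bcut (~: T) (badd x z)) bzero; last first.
  by rewrite !B0 ?hy // mul0r mulr0.
have sST : S \subset ~: T by rewrite -finset.disjoints_subset.
have sTS : T \subset ~: S by rewrite -finset.disjoints_subset disjoint_sym.
have mS : bcut S (badd x z) = bzero by rewrite -(bcut_subl _ sST) Tz bcut0.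
have mT : bcut T (badd z y) = bzero by rewrite -(bcut_subl _ sTS) Sz bcut0.
rewrite -(Am _ _ (h z) mS) -(Bm _ (h z) _ mT) mulrC; congr (coef B _ _ * coef A _ _).
- by rewrite /h baddK.
- by rewrite baddC baddK.
- by rewrite baddA baddbb baddC badd0.
- by rewrite -hy baddA baddbb baddC badd0.
Qed.

End OneSystem.

(** * Gates in the Heisenberg picture and light cones *)

Section Gates.
Variable Q : finType.
Implicit Types (A B : op Q) (g h : gate R Q) (x y z m : bits Q) (S T : {set Q}).

Definition gate_support g : {set Q} := [set q | q \in codom (wires g)].

Lemma card_gate_support g : (#|gate_support g| <= 2)%N.
Proof.
rewrite cardsE; apply: leq_trans (card_size _) _.
by rewrite size_codom card_ord (arity_le2 g).
Qed.

Lemma gate_agreeP g x y :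
  [forall q, (q \in codom (wires g)) || (x q == y q)] =
  (bcut (~: gate_support g) (badd x y) == bzero).
Proof.
apply/forallP/eqP => [xy|/ffunP xy q].
  apply/ffunP => q; have := xy q; rewrite bcutE baddE ffunE !inE.
  by case: (q \in _) => //= /eqP ->; rewrite addbb.
by have := xy q; rewrite bcutE baddE ffunE !inE; case: (q \in _) => //=; case: (x q); case: (y q).
Qed.

Lemma gate_op_local g : local (gate_support g) (gate_op g).
Proof.
split => [x y|m x y m0]; rewrite !coef_mkop !gate_agreeP; first by move/negbTE->.
have -> : badd (badd x m) (badd y m) = badd x y.
  by rewrite (baddC y) baddA baddK.
have mw i : m (wires g i) = false.
  by have /ffunP /(_ (wires g i)) := m0; rewrite bcutE ffunE inE codom_f.
by case: ifP => // _; congr (coef _ _ _); apply/ffunP => i; rewrite !ffunE mw addbF.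
Qed.

(** A string agreeing with x off the support is determined by its bits on the wires, which are free
    because the wires are distinct. Sums over the register thus reduce to sums over the indices of
    the gate's own matrix. *)
Lemma sum_gate_agree g x (F : bits 'I_(arity g) -> C) :
  \sum_(z | bcut (~: gate_support g) (badd x z) == bzero)
    F [ffun i => z (wires g i)] = \sum_b F b.
Proof.
pose put (b : bits 'I_(arity g)) : bits Q :=
  [ffun q => if [pick i | wires g i == q] is Some i then b i else x q].
have putK b : [ffun i => put b (wires g i)] = b.
  apply/ffunP => i; rewrite !ffunE; case: pickP => [j /eqP /wires_inj -> //|/(_ i)].
  by rewrite eqxx.
rewrite [LHS](reindex_onto put (fun z => [ffun i => z (wires g i)])) /=.
  apply: eq_big => [b|b _]; last by rewrite putK.
  rewrite putK eqxx andbT; apply/eqP/ffunP => q.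
  rewrite bcutE !inE baddE !ffunE; case: pickP => [i /eqP <-|/=]; first by rewrite codom_f.
  by rewrite addbb andbF.
move=> z /eqP /ffunP xz; apply/ffunP => q; rewrite !ffunE.
case: pickP => [i /eqP <-|noi]; first by rewrite ffunE.
have := xz q; rewrite bcutE baddE !inE ffunE.
have -> : (q \in codom (wires g)) = false.
  by apply/negbTE/codomP => -[i qi]; have := noi i; rewrite qi eqxx.
by case: (x q); case: (z q).
Qed.

Lemma gate_op_unitary g : gate_op g \is unitarymx.
Proof.
apply/unitarymxP/coefP => x y; rewrite coef_mul coef1.
have E z : coef (gate_op g) x z * coef ((gate_op g)^t*) z y =
    if bcut (~: gate_support g) (badd x z) == bzero then
      (if bcut (~: gate_support g) (badd y z) == bzero then
      coef (unitary g) [ffun i => x (wires g i)] [ffun i => z (wires g i)] *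
      (coef (unitary g) [ffun i => y (wires g i)] [ffun i => z (wires g i)])^* else 0) else 0.
  rewrite coef_adj !coef_mkop !gate_agreeP.
  by case: ifP => _; rewrite ?mul0r //; case: ifP => _; rewrite ?conjC0 ?mulr0.
rewrite (eq_bigr _ (fun z _ => E z)) -big_mkcond /=.
have [xy|xy] := eqVneq (bcut (~: gate_support g) (badd x y)) bzero; last first.
  rewrite big1 => [|z /eqP xz].
    by case: (x =P y) xy => // ->; rewrite baddbb bcut0 eqxx.
  case: ifP => // /eqP yz; case/eqP: xy.
  by rewrite -(baddK z x) -baddA bcut_badd xz (baddC z) yz badd0.
have yx z : bcut (~: gate_support g) (badd x z) == bzero ->
    bcut (~: gate_support g) (badd y z) == bzero.
  by move=> /eqP xz; rewrite -(baddK x y) -baddA bcut_badd (baddC y) xy xz badd0.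
rewrite (eq_bigr (fun z => coef (unitary g) [ffun i => x (wires g i)] [ffun i => z (wires g i)] *
      (coef (unitary g) [ffun i => y (wires g i)] [ffun i => z (wires g i)])^*)); last first.
  by move=> z /yx ->.
rewrite (sum_gate_agree x (fun b => coef (unitary g) [ffun i => x (wires g i)] b *
      (coef (unitary g) [ffun i => y (wires g i)] b)^*)).
transitivity (coef (unitary g *m (unitary g)^t*) [ffun i => x (wires g i)] [ffun i => y (wires g i)]).
  by rewrite coef_mul; apply: eq_bigr => b _; rewrite coef_adj.
have /unitarymxP -> := unitaryP g; rewrite coef1; congr (_ %:R); congr nat_of_bool.
apply/eqP/eqP => [/ffunP W|-> //]; apply/ffunP => q.
have /ffunP /(_ q) := xy; rewrite bcutE baddE !inE ffunE.
case: (boolP (q \in _)) => [/codomP[i ->] _|_ /=]; first by have := W i; rewrite !ffunE.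
by case: (x q); case: (y q).
Qed.

Definition heisenberg (gs : seq (gate R Q)) A : op Q :=
  foldr (fun g B => (gate_op g)^t* *m B *m gate_op g) A gs.

(** Cyclicity of the trace moves each conjugation from the state to the observable. The first gate
    to act on the state is the last to act on the observable, hence [foldl] against [foldr]. *)
Lemma mxtrace_heisenberg gs A s :
  \tr (A *m foldl (fun s g => gate_op g *m s *m (gate_op g)^t*) s gs) =
  \tr (heisenberg gs A *m s).
Proof.
elim: gs s => //= g gs IH s; rewrite IH mulmxA mxtrace_mulC !mulmxA.
by rewrite -!mulmxA.
Qed.

(** A gate inside S leaves every factor local to S; a gate disjoint from S commutes with A and
    cancels against its adjoint. *)
Lemma heisenberg_gate_local g S A : local S A ->
  gate_support g \subset S \/ [disjoint gate_support g & S] ->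
  local S ((gate_op g)^t* *m A *m gate_op g).
Proof.
move=> SA [gS|gS].
  have Sg := localS gS (gate_op_local g).
  by apply: local_mul => //; apply: local_mul => //; apply: local_adj.
rewrite -mulmxA (local_comm _ SA (gate_op_local g)) 1?disjoint_sym // mulmxA.
have -> : (gate_op g)^t* *m gate_op g = 1%:M.
  apply: mulmx1C; exact/unitarymxP/gate_op_unitary.
by rewrite mul1mx.
Qed.

(* Since the gates of a layer are disjoint, each gate meeting the cone uses up *)
(* a qubit of S and adds at most one qubit to the cone, which thus at most     *)
(* doubles.                                                                    *)
Lemma layer_cone gs S : pairwise (@disjoint_gates R Q) gs ->
  exists T : {set Q}, [/\ T \subset S :|: \bigcup_(g <- gs) gate_support g,
    (#|T| <= #|S| + #|S :&: \bigcup_(g <- gs) gate_support g|)%N &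
    forall A, local S A -> local T (heisenberg gs A)].
Proof.
elim: gs => [_|g gs IH /=/andP[ggs /IH[T [TS cT lT]]]].
  by exists S; rewrite big_nil finset.setU0 finset.setI0 cards0 addn0; split.
have dg : [disjoint gate_support g & \bigcup_(h <- gs) gate_support h].
  elim: gs ggs {IH TS cT lT} => [|h gs IH] /=; first by rewrite big_nil -finset.setI_eq0 finset.setI0.
  case/andP=> gh /IH; rewrite big_cons -!finset.setI_eq0 finset.setIUr => /eqP ->.
  rewrite finset.setU0; move: gh => /pred0P gh.
  by apply/eqP/finset.setP => q; rewrite !inE; have := gh q.
set U := \bigcup_(h <- gs) _ in TS cT dg *.
rewrite big_cons -/U.
have SU : #|S :&: (gate_support g :|: U)| = (#|S :&: gate_support g| + #|S :&: U|)%N.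
  rewrite finset.setIUr cardsU finset.setIACA finset.setIid; move: dg; rewrite -finset.setI_eq0 => /eqP ->.
  by rewrite finset.setI0 cards0 subn0.
have [gT|gT] := boolP [disjoint gate_support g & T].
  exists T; split; first by apply: fintype.subset_trans TS _; rewrite finset.setUCA finset.subsetUr.
    by rewrite SU addnCA; apply: leq_trans cT (leq_addl _ _).
  by move=> A /lT; move/heisenberg_gate_local; apply; right.
(* The gate meets T, which lies in the union of S and the supports of the other gates; being
   disjoint from the latter, it meets S. The first clause of the statement is carried through the
   induction for this. *)
have gS : (0 < #|S :&: gate_support g|)%N.
  rewrite card_gt0; apply: contraNneq gT => gS.
  apply/pred0P => q /=; apply/negbTE/negP => /andP[qg qT].
  have := fintype.subsetP TS q qT; rewrite inE (disjointFr dg qg) orbF => qS.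
  by have /finset.setP/(_ q) := gS; rewrite inE qg qS inE.
exists (gate_support g :|: T); split.
- by rewrite finset.setUCA finset.setUS.
- have : (#|gate_support g :|: T| <= #|T| + 1)%N.
    rewrite cardsU -addnBAC; last exact: subset_leq_card (finset.subsetIl _ _).
    rewrite addnC leq_add2l leq_subLR (leq_trans (card_gate_support g)) // addn1 ltnS.
    move: gT; rewrite -finset.setI_eq0 -card_gt0 //.
  move/leq_trans; apply; rewrite SU addnCA addnC.
  by apply: leq_add.
- move=> A /lT TA; apply: heisenberg_gate_local; first exact: localS (finset.subsetUr _ _) TA.
  by left; apply: finset.subsetUl.
Qed.

Lemma circuit_cone (ls : seq (seq (gate R Q))) S :
  all (pairwise (@disjoint_gates R Q)) ls ->
  exists2 T : {set Q}, (#|T| <= 2 ^ size ls * #|S|)%N &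
    forall A, local S A -> local T (heisenberg (flatten ls) A).
Proof.
elim: ls => [_|l ls IH /=/andP[pl /IH[T cT lT]]]; first by exists S; rewrite // mul1n.
have [U [_ cU lU]] := layer_cone T pl; exists U.
  rewrite expnS -mulnA; apply: leq_trans (leq_mul (leqnn 2) cT).
  by apply: leq_trans cU _; rewrite mul2n -addnn leq_add2l subset_leq_card // finset.subsetIl.
by move=> A SA; rewrite /heisenberg foldr_cat; apply/lU/lT.
Qed.

Lemma heisenberg_proj gs A : A^t* = A -> A *m A = A ->
  (heisenberg gs A)^t* = heisenberg gs A /\
  heisenberg gs A *m heisenberg gs A = heisenberg gs A.
Proof.
move=> Ah Ap; elim: gs => [//|g gs [IHh IHp]].
exact: (unitary_conj_proj (gate_op_unitary g) IHh IHp).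
Qed.

(** A diagonal entry of a projector is the squared norm of its row, so |A x y|^2 <= A x x, and the
    case y = x gives A x x <= 1. *)
Lemma proj_coef_le1 A x y : A^t* = A -> A *m A = A -> `|coef A x y| <= 1.
Proof.
move=> Ah Ap.
have E : coef A x x = \sum_z `|coef A x z| ^+ 2.
  rewrite -{1}Ap coef_mul; apply: eq_bigr => z _.
  by rewrite -{2}Ah coef_adj normCK.
have le z : `|coef A x z| ^+ 2 <= coef A x x.
  rewrite E (bigD1 z) //= lerDl; apply: sumr_ge0 => t _; exact: exprn_ge0.
have A0 : 0 <= coef A x x by apply: le_trans (le x); exact: exprn_ge0.
have A1 : coef A x x <= 1.
  have := le x; rewrite ger0_norm // expr2.
  have [->//|An0] := eqVneq (coef A x x) 0; rewrite -subr_ge0 -{1}[coef A x x]mul1r -mulrBl.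
  by rewrite pmulr_lge0 ?subr_ge0 // lt0r An0.
by rewrite -(@expr_le1 _ 2) //; apply: le_trans (le y) A1.
Qed.

End Gates.
End Operators.

(** * Duality for the trace norm *)

Section TraceNorm.
Variable R : realType.
Local Notation C := R[i].

(** Cauchy-Schwarz with b normalised, by summing 2 s a b <= a^2 + s^2 b^2. *)
Lemma cauchy_schwarz_unit (I : finType) (a b : I -> C) (s : C) :
  (forall i, 0 <= a i) -> (forall i, 0 <= b i) -> 0 <= s ->
  \sum_i a i ^+ 2 = s ^+ 2 -> \sum_i b i ^+ 2 = 1 -> \sum_i a i * b i <= s.
Proof.
move=> a0 b0 s0 as2 b1; have [s_eq0|s_neq0] := eqVneq s 0.
  rewrite s_eq0 big1 // => i _.
  move: as2; rewrite s_eq0 expr0n /= => /eqP; rewrite psumr_eq0; last by move=> j _; exact: exprn_ge0.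
  by move=> /allP /(_ i); rewrite mem_index_enum sqrf_eq0 => /(_ isT) /eqP ->; rewrite mul0r.
have s_gt0 : 0 < s by rewrite lt0r s_neq0.
rewrite -(@ler_pM2l _ (2 * s)) ?mulr_gt0 // mulr_sumr.
have -> : 2 * s * s = \sum_i (a i ^+ 2 + s ^+ 2 * b i ^+ 2).
  by rewrite big_split /= -mulr_sumr b1 as2 mulr1 -mulrA -expr2 mulr_natl mulr2n.
apply: ler_sum => i _; rewrite -subr_ge0.
have -> : a i ^+ 2 + s ^+ 2 * b i ^+ 2 - 2 * s * (a i * b i) = (a i - s * b i) ^+ 2 by ring.
have r : a i - s * b i \is Num.real by rewrite realB // ger0_real // mulr_ge0.
by rewrite -real_normK //; exact: exprn_ge0.
Qed.

Lemma unitarymx_row_norm n (U : 'M[C]_n) k : U \is unitarymx -> \sum_j `|U k j| ^+ 2 = 1.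
Proof.
move=> /unitarymxP /matrixP /(_ k k); rewrite !mxE eqxx mulr1n => <-.
by apply: eq_bigr => j _; rewrite !mxE normCK.
Qed.

(* Duality of the trace norm with the operator norm, for a weighted            *)
(* permutation matrix of operator norm at most 1.                              *)
Lemma trace_norm_duality n (M : 'M[C]_n) (b : 'I_n -> C) (p : 'I_n -> 'I_n) :
  injective p -> (forall i, `|b i| <= 1) ->
  `|\sum_i b i * M i (p i)| <= (trace_norm M)%:C%C.
Proof.
move=> p_inj b1; set A := M^t* *m M.
have Anormal : A \is normalmx.
  by apply/normalmxP; rewrite /A !trmx_mul !map_mxM !trmxCK.
have Aspec := orthomx_spectralP Anormal.
set V := spectralmx A in Aspec; set D := spectral_diag A in Aspec.
have Vu : V \is unitarymx := spectral_unitarymx A.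
have VV : V *m V^t* = 1%:M by apply/unitarymxP.
have VV' : V^t* *m V = 1%:M by apply: mulmx1C.
(* The columns of N are orthogonal with squared norms D, so M = N V is a singular value
   decomposition with unnormalised left vectors. Cauchy-Schwarz is applied, for each k, to column k
   of N and row k of V permuted by p. *)
pose N := M *m V^t*.
have MN : M = N *m V by rewrite /N -mulmxA VV' mulmx1.
have NN : N^t* *m N = diag_mx D.
  rewrite /N trmx_mul map_mxM trmxCK -mulmxA (mulmxA _ M) -/A Aspec invmx_unitary //.
  by rewrite !mulmxA VV mul1mx -mulmxA VV mulmx1.
have ND k : \sum_i `|N i k| ^+ 2 = D 0 k.
  have := congr1 (fun B => fun_of_matrix B k k) NN; rewrite !mxE eqxx mulr1n => <-.
  by apply: eq_bigr => i _; rewrite !mxE normCK mulrC.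
have D0 k : 0 <= D 0 k by rewrite -ND; apply: sumr_ge0 => i _; exact: exprn_ge0.
have -> : \sum_i b i * M i (p i) = \sum_k \sum_i b i * (N i k * V k (p i)).
  rewrite exchange_big; apply: eq_bigr => i _.
  by rewrite {1}MN mxE mulr_sumr.
have -> : (trace_norm M)%:C%C = \sum_k sqrtC (D 0 k).
  rewrite /trace_norm rmorph_sum; apply: eq_bigr => k _.
  by apply: RRe_real; rewrite ger0_real // sqrtC_ge0.
apply: le_trans (ler_norm_sum _ _ _) _.
apply: ler_sum => k _; apply: le_trans (ler_norm_sum _ _ _) _.
apply: le_trans (_ : \sum_i `|N i k| * `|V k (p i)| <= _).
  apply: ler_sum => i _; rewrite !normrM -[leRHS]mul1r.
  by apply: ler_wpM2r; rewrite ?mulr_ge0.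
apply: cauchy_schwarz_unit => //; first by rewrite sqrtC_ge0.
  by rewrite sqrtCK ND.
by rewrite -(unitarymx_row_norm k Vu) [RHS](reindex_inj p_inj).
Qed.

End TraceNorm.

(** * Partial trace against the ancillas *)

Section Density.
Variable R : realType.
Local Notation C := R[i].
Variable Q : finType.
Implicit Types (rho : 'M[C]_#|{: bits Q}|) (a b : bits Q).

(** Positivity tested on the vector e_a + s e_b. *)
Lemma density_pair rho a b (s : C) : density rho ->
  0 <= coef rho a a + coef rho b b * (s * s^*) + (s * coef rho a b + s^* * coef rho b a).
Proof.
move=> [/(_ (delta_mx (enum_rank a) 0 + s *: delta_mx (enum_rank b) 0)) + _].
have -> : (delta_mx (enum_rank a) 0 + s *: delta_mx (enum_rank b) 0)^t* =
    delta_mx 0 (enum_rank a) + s^* *: delta_mx 0 (enum_rank b) :> 'rV[C]_#|{: bits Q}|.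
  by apply/matrixP => i j; rewrite !mxE rmorphD rmorphM /= !rmorph_nat ![_ && (i == 0)]andbC.
rewrite !(mulmxDl, mulmxDr) -!scalemxAl -!scalemxAr -!rowE -!colE !mxE /coef.
by congr (0 <= _); ring.
Qed.

(** The values 1, -1, i, -i of s in [density_pair] bound rho_ab + rho_ba and i (rho_ab - rho_ba),
    which together recover 2 rho_ab. The bound is twice the sharp one, which is harmless. *)
Lemma density_coef_le rho a b : density rho -> `|coef rho a b| <= coef rho a a + coef rho b b.
Proof.
move=> drho; pose p := coef rho a a + coef rho b b.
have norm_le (q : C) : 0 <= p + q -> 0 <= p - q -> `|q| <= p.
  move=> h1 h2; have p0 : 0 <= p.
    by rewrite -(@pmulr_lge0 _ 2) // mulr_natr mulr2n -[X in X + _](addrK q) addrAC -addrA addr_ge0.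
  have qr : q \is Num.real by rewrite -(addKr p q) realD ?realN ?ger0_real.
  rewrite real_ler_norml //; apply/andP; split; rewrite -subr_ge0 //.
  by rewrite opprK addrC.
have h1 : `|coef rho a b + coef rho b a| <= p.
  apply: norm_le; rewrite /p.
    by have := density_pair a b 1 drho; rewrite conjC1 !mulr1 !mul1r.
  by have := density_pair a b (-1) drho; rewrite rmorphN rmorph1 mulrNN !mulr1 !mulN1r -opprD.
have h2 : `|'i%R * (coef rho a b - coef rho b a)| <= p.
  apply: norm_le; rewrite /p.
    have := density_pair a b 'i%R drho; rewrite conjCi mulrN -expr2 sqrCi opprK mulr1.
    by rewrite mulrBr mulNr.
  have iJ : (- 'i%R)^* = 'i%R :> C by rewrite rmorphN /= conjCi opprK.
  have := density_pair a b (- 'i%R) drho; rewrite iJ mulNr -expr2 sqrCi opprK mulr1.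
  by rewrite mulrBr mulNr opprB addrC [- _ + _]addrC addrC.
rewrite -(@ler_pM2l _ 2) // -[X in X * `|_|](@ger0_norm _ 2) // -normrM.
have -> : 2 * coef rho a b =
    (coef rho a b + coef rho b a) - 'i%R * ('i%R * (coef rho a b - coef rho b a)).
  by rewrite mulrA -expr2 sqrCi; ring.
apply: le_trans (ler_normB _ _) _; rewrite normrM normCi mul1r mulr_natl mulr2n.
exact: lerD.
Qed.

End Density.

Section Joins.
Variables Q1 Q2 : finType.

Definition bjoin (x : bits Q1) (a : bits Q2) : bits (Q1 + Q2)%type :=
  [ffun q => match q with inl i => x i | inr j => a j end].

Lemma bjoinl x a : [ffun q => bjoin x a (inl q)] = x.
Proof. by apply/ffunP => q; rewrite !ffunE. Qed.

Lemma bjoinr x a : [ffun q => bjoin x a (inr q)] = a.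
Proof. by apply/ffunP => q; rewrite !ffunE. Qed.

Lemma bjoin_addr x a y b : badd (bjoin x a) (bjoin y b) = bjoin (badd x y) (badd a b).
Proof. by apply/ffunP => -[q|q]; rewrite !(baddE, ffunE). Qed.

Lemma bcut_bjoin (S : {set Q1 + Q2}) x a :
  bcut S (bjoin x a) = bjoin (bcut [set q | inl q \in S] x) (bcut [set q | inr q \in S] a).
Proof. by apply/ffunP => -[q|q]; rewrite !(bcutE, ffunE, inE). Qed.

Lemma bjoin_eq0 x a : (bjoin x a == bzero) = (x == bzero) && (a == bzero).
Proof.
apply/eqP/andP => [/ffunP xa|[/eqP-> /eqP->]]; last first.
  by apply/ffunP => -[q|q]; rewrite !ffunE.
split; apply/eqP/ffunP => q.
  by have := xa (inl q); rewrite !ffunE.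
by have := xa (inr q); rewrite !ffunE.
Qed.

Lemma sum_bjoin (V : nmodType) (F : bits (Q1 + Q2)%type -> V) :
  \sum_X F X = \sum_x \sum_a F (bjoin x a).
Proof.
rewrite pair_bigA /=.
rewrite (reindex (fun p : bits Q1 * bits Q2 => bjoin p.1 p.2)) //=.
exists (fun X => ([ffun q => X (inl q)], [ffun q => X (inr q)])) => [[x a] _|X _] /=.
  by congr pair; apply/ffunP => q; rewrite !ffunE.
by apply/ffunP => -[q|q]; rewrite !ffunE.
Qed.

End Joins.

Section PartialTrace.
Variable R : realType.
Local Notation C := R[i].
Variables Q1 Q2 : finType.
Variables (O : 'M[C]_#|{: bits (Q1 + Q2)%type}|) (alpha : 'M[C]_#|{: bits Q2}|).

(** The entry (y, x) of the partial trace over Q2 of O (1 ⊗ alpha): the observable seen by the input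
    when the ancillas start in alpha. *)
Definition ptrace (y x : bits Q1) : C :=
  \sum_a \sum_b coef O (bjoin y b) (bjoin x a) * coef alpha a b.

Lemma mxtrace_tensor rho :
  \tr (O *m tensor rho alpha) = \sum_x \sum_y ptrace y x * coef rho x y.
Proof.
rewrite mxtrace_coef sum_bjoin exchange_big /=.
under eq_bigr do under eq_bigr do rewrite coef_mul sum_bjoin.
rewrite exchange_big /=.
under eq_bigr do rewrite exchange_big /=.
rewrite exchange_big /=; apply: eq_bigr => x _; apply: eq_bigr => y _.
rewrite /ptrace exchange_big mulr_suml; apply: eq_bigr => b _.
rewrite mulr_suml; apply: eq_bigr => a _; rewrite coef_mkop -mulrA [coef alpha _ _ * _]mulrC.
by rewrite !bjoinl !bjoinr.
Qed.

Variable S : {set Q1 + Q2}.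
Hypothesis O_local : local S O.

Lemma ptrace_eq0 x w : bcut [set q | inl q \in S] w != w -> ptrace (badd x w) x = 0.
Proof.
move=> w0; apply: big1 => a _; apply: big1 => b _.
case: O_local => O0 _; rewrite O0 ?mul0r // bjoin_addr bcut_bjoin bjoin_eq0.
rewrite negb_and (_ : [set q | inl q \in ~: S] = ~: [set q | inl q \in S]).
  by rewrite bcutC_eq0 (baddC x) baddK w0.
by apply/finset.setP => q; rewrite !inE.
Qed.

Lemma ptrace_badd x y m : bcut [set q | inl q \in S] m = bzero ->
  ptrace (badd y m) (badd x m) = ptrace y x.
Proof.
move=> m0; apply: eq_bigr => a _; apply: eq_bigr => b _.
case: O_local => _ Om; rewrite -(Om (bjoin m bzero) (bjoin y b)) ?bjoin_addr ?badd0 //.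
by apply/eqP; rewrite bcut_bjoin bjoin_eq0 m0 bcut0 !eqxx.
Qed.

(** Only the pairs b = w + a with w supported on the ancilla part of S contribute. For each of these
    at most 2^|S| shifts w, the bound by alpha_aa + alpha_bb sums to twice the trace of alpha,
    uniformly in the number of ancillas. *)
Lemma ptrace_le x y : (forall X Y, `|coef O X Y| <= 1) -> density alpha ->
  `|ptrace y x| <= (2 * 2 ^ #|S|)%:R.
Proof.
move=> O1 da; set Sa := [set q | inr q \in S].
have le1 a b : `|coef O (bjoin y b) (bjoin x a) * coef alpha a b| <=
    if bcut Sa (badd b a) == badd b a then coef alpha a a + coef alpha b b else 0.
  case: ifP => [_|w0].
    rewrite normrM -[leRHS]mul1r; apply: ler_pM => //; exact: density_coef_le.
  case: O_local => O0 _; rewrite O0 ?mul0r ?normr0 //.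
  rewrite bjoin_addr bcut_bjoin bjoin_eq0 negb_and orbC.
  rewrite (_ : [set q | inr q \in ~: S] = ~: Sa) ?bcutC_eq0 ?w0 //.
  by apply/finset.setP => q; rewrite !inE.
apply: le_trans (ler_norm_sum _ _ _) _.
apply: le_trans (ler_sum _ (fun a _ => ler_norm_sum _ _ _)) _.
apply: le_trans (ler_sum _ (fun a _ => ler_sum _ (fun b _ => le1 a b))) _.
under eq_bigr => a _ do rewrite (reindex_inj (@badd_inj _ a)) /=.
under eq_bigr => a _ do under eq_bigr => b _ do rewrite baddK.
rewrite exchange_big /= -(@eq_bigr _ _ _ _ _ _ (fun w => if bcut Sa w == w then 2 else 0)).
  rewrite -big_mkcond sumr_const -mulrnA ler_nat leq_mul2l /=.
  rewrite card_bcut leq_exp2l // -(card_imset _ (@inr_inj Q1 Q2)).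
  apply: subset_leq_card; apply/fintype.subsetP => q /imsetP[r + ->].
  by rewrite inE.
move=> w _; case: ifP => _; last by rewrite big1.
have [_ tr1] := da; rewrite big_split /= -mxtrace_coef tr1.
have <- : \tr alpha = \sum_i coef alpha (badd w i) (badd w i).
  rewrite mxtrace_coef (reindex_inj (@badd_inj _ w)).
  by apply: eq_bigr => i _; rewrite baddC.
by rewrite tr1.
Qed.

End PartialTrace.

(** * Light cone of a circuit *)

Section Copies.
Variable Q : finType.
Variable t : nat.
Implicit Types (x : bits ('I_t * Q)%type) (T : {set 'I_t * Q}).

Definition copy_bits x (j : 'I_t) : bits Q := [ffun q => x (j, q)].
Definition copy_set T (j : 'I_t) : {set Q} := [set q | (j, q) \in T].

Lemma copy_bitsE x j q : copy_bits x j q = x (j, q). Proof. exact: ffunE. Qed.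

Lemma copy_bits_badd x y j : copy_bits (badd x y) j = badd (copy_bits x j) (copy_bits y j).
Proof. by apply/ffunP => q; rewrite !(baddE, copy_bitsE). Qed.

Lemma bcut_copies T u x :
  (bcut T x == u) = [forall j, bcut (copy_set T j) (copy_bits x j) == copy_bits u j].
Proof.
apply/eqP/forallP => [<- j|xu].
  by apply/eqP/ffunP => q; rewrite !(bcutE, copy_bitsE) inE.
apply/ffunP => -[j q]; have /eqP/ffunP/(_ q) := xu j.
by rewrite !(bcutE, copy_bitsE) inE.
Qed.

Lemma sum_prod_copies (K : comNzRingType) T u (F : 'I_t -> bits Q -> K) :
  \sum_(x | bcut T x == u) \prod_j F j (copy_bits x j) =
  \prod_j \sum_(y | bcut (copy_set T j) y == copy_bits u j) F j y.
Proof.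
rewrite (bigA_distr_big_dep (fun j y => bcut (copy_set T j) y == copy_bits u j)) /=.
pose unc (g : {ffun 'I_t -> bits Q}) : bits ('I_t * Q)%type := [ffun p => g p.1 p.2].
have uncK g j : copy_bits (unc g) j = g j.
  by apply/ffunP => q; rewrite copy_bitsE ffunE.
rewrite (reindex unc) /=; last first.
  exists (fun x => [ffun j => copy_bits x j]) => [g _|x _].
    by apply/ffunP => j; rewrite ffunE uncK.
  by apply/ffunP => -[j q]; rewrite !ffunE.
apply: eq_big => [g|g _]; last by apply: eq_bigr => j _; rewrite uncK.
rewrite bcut_copies; apply/forallP/familyP => gu j; have := gu j;
  by rewrite ?uncK unfold_in.
Qed.

End Copies.

Section LightCone.
Variable R : realType.
Local Notation C := R[i].
Local Notation ket Q := 'cV[C]_#|{: bits Q}|.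

Definition amp (Q : finType) (psi : ket Q) (x : bits Q) : C := psi (enum_rank x) 0.

(* For u and w supported on T, this is the entry (u, u + w) of the reduced     *)
(* density matrix of psi on the qubits T.                                      *)
Definition reduced (Q : finType) (T : {set Q}) (u w : bits Q) (psi : ket Q) : C :=
  \sum_(x | bcut T x == u) amp psi x * (amp psi (badd x w))^*.

Lemma coef_projector (Q : finType) (psi : ket Q) x y :
  coef (projector psi) x y = amp psi x * (amp psi y)^*.
Proof. by rewrite /coef /projector mxE big_ord1 !mxE. Qed.

Lemma coef_copies (Q : finType) t (A : 'M[C]_#|{: bits Q}|) x y :
  coef (copies t A) x y = \prod_j coef A (copy_bits x j) (copy_bits y j).
Proof. by rewrite coef_mkop. Qed.

Definition outcome_proj (In : finType) k (c : circuit R In k) (z : bits 'I_k) :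
    'M[C]_#|{: bits (In + 'I_(ancillas c))%type}| :=
  mkop (fun x y => ((x == y) && ([ffun i => x (outputs c i)] == z))%:R).

Lemma output_mxtrace (In : finType) k (c : circuit R In k) rho z :
  output c rho z = complex.Re (\tr (outcome_proj c z *m final_state c rho)).
Proof.
rewrite mxtrace_coef (raddf_sum (@complex.Re R : Rcomplex R -> R)) /= /output big_mkcond /=.
apply: eq_bigr => x _; rewrite coef_mul (bigD1 x) //= big1 ?addr0 => [|y yx].
  by rewrite coef_mkop eqxx /=; case: ifP => _; rewrite ?mul1r ?mul0r.
by rewrite coef_mkop eq_sym (negbTE yx) mul0r.
Qed.

Lemma outcome_proj_local (In : finType) k (c : circuit R In k) z :
  local [set outputs c i | i : 'I_k] (outcome_proj c z).
Proof.
set S := [set _ | _ in _].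
split => [x y|m x y m0]; rewrite !coef_mkop.
  by case: (x =P y) => // <-; rewrite baddbb bcut0 eqxx.
rewrite (inj_eq (@badd_inj _ m)); congr (_ && (_ == _))%:R.
apply/ffunP => i; rewrite !ffunE.
have /ffunP /(_ (outputs c i)) := m0; rewrite bcutE ffunE imset_f //= => ->.
by rewrite addbF.
Qed.

Lemma outcome_projP (In : finType) k (c : circuit R In k) z :
  (outcome_proj c z)^t* = outcome_proj c z /\
  outcome_proj c z *m outcome_proj c z = outcome_proj c z.
Proof.
split; apply: coefP => x y; rewrite ?coef_adj ?coef_mul !coef_mkop.
  by rewrite rmorph_nat eq_sym; case: (x =P y) => [->|].
rewrite (bigD1 x) //= big1 ?addr0 => [|w wx].
  by rewrite !coef_mkop eqxx /=; case: (_ == z); rewrite ?andbT ?andbF ?mul1r ?mul0r.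
by rewrite coef_mkop eq_sym (negbTE wx) mul0r.
Qed.

(** K w u is the entry (u + w, u) of the observable pulled back to the input. By locality it sees
    only the bits in T, so the bits outside T are summed in the state alone; the state being a
    product over copies, this sum factors into entries of reduced states. *)
Lemma output_reduced (Q : finType) t k (c : circuit R ('I_t * Q)%type k) z :
  exists (T : {set 'I_t * Q}) (K : bits ('I_t * Q)%type -> bits ('I_t * Q)%type -> C),
  [/\ (#|T| <= 2 ^ circuit_depth c * k)%N,
      forall w u, `|K w u| <= (2 * 2 ^ (2 ^ circuit_depth c * k))%:R &
      forall psi, output c (copies t (projector psi)) z =
        complex.Re (\sum_(w | bcut T w == w) \sum_(u | bcut T u == u)
           K w u * \prod_j reduced (copy_set T j) (copy_bits u j) (copy_bits w j) psi)].
Proof.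
have [S cS lS] := circuit_cone [set outputs c i | i : 'I_k] (layers_disjoint c).
have {}cS : (#|S| <= 2 ^ circuit_depth c * k)%N.
  by move: cS; rewrite (card_imset _ (@outputs_inj _ _ _ c)) card_ord.
set O := heisenberg (flatten (layers c)) (outcome_proj c z).
have Ol : local S O := lS _ (outcome_proj_local c z).
have [Oh Op] : O^t* = O /\ O *m O = O.
  by have [? ?] := outcome_projP c z; apply: heisenberg_proj.
pose T := [set q | inl q \in S]; pose K w u := ptrace O (ancilla_state c) (badd u w) u.
exists T, K; split=> [|w u|psi].
- apply: leq_trans cS; rewrite -(card_imset _ (@inl_inj ('I_t * Q)%type 'I_(ancillas c))).
  by apply: subset_leq_card; apply/fintype.subsetP => q /imsetP[r + ->]; rewrite inE.
- apply: le_trans (ptrace_le Ol _ _ _ (ancilla_density c)) _.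
    by move=> X Y; apply: proj_coef_le1.
  by rewrite ler_nat leq_mul2l leq_exp2l.
rewrite output_mxtrace /final_state mxtrace_heisenberg -/O mxtrace_tensor; congr complex.Re.
have KT w u x : bcut T x = u -> K w x = K w u.
  move=> xu; rewrite /K -(ptrace_badd (ancilla_state c) Ol x (badd x w) (m := bcut (~: T) x)).
    by rewrite (baddC x w) -baddA badd_bcutC xu baddC.
  by rewrite bcut_disjoint // -finset.setI_eq0 finset.setICr.
(* The index y becomes w + x, so that w records the off-diagonal shift; a shift not supported on T
   contributes 0. *)
under eq_bigr => x _ do rewrite (reindex_inj (inj_comp (@badd_inj _ x) (fun a b (ab : a = b) => ab))) /=.
rewrite exchange_big /= [RHS]big_mkcond; apply: eq_bigr => w _.
case: ifP => [wT|/negbT wT]; last first.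
  by apply: big1 => x _; rewrite baddC (ptrace_eq0 _ Ol) ?mul0r.
rewrite (partition_big (bcut T) (fun u => bcut T u == u)) /=; last first.
  by move=> x _; rewrite bcut_id.
apply: eq_bigr => u uT; rewrite -sum_prod_copies mulr_sumr; apply: eq_bigr => x /eqP xu.
rewrite (baddC w) -/(K w x) (KT w u x xu) coef_copies; congr (_ * _).
by apply: eq_bigr => j _; rewrite coef_projector copy_bits_badd.
Qed.

End LightCone.

(** * Deviation from the maximally mixed state *)

Section Deviation.
Variable R : realType.
Local Notation C := R[i].
Local Notation ket Q := 'cV[C]_#|{: bits Q}|.

Definition sqn (z : C) : R := complex.Re z ^+ 2 + complex.Im z ^+ 2.

Lemma sqnE (z : C) : (sqn z)%:C%C = z * z^*.
Proof. by rewrite /sqn add_Re2_Im2 normCK. Qed.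

Lemma sqn_ge0 (z : C) : 0 <= sqn z.
Proof. by rewrite addr_ge0 // sqr_ge0. Qed.

(** Trades a modulus for its square, whose mean is linear in the second moment; s is only chosen at
    the very end. *)
Lemma norm_le_sqn (z : C) (s : R) : 0 < s -> `|z| <= (s + sqn z / s)%:C%C.
Proof.
move=> s0; rewrite normc_def lecR -/(sqn z).
set a := Num.sqrt _; have a2 : a ^+ 2 = sqn z by rewrite sqr_sqrtr // sqn_ge0.
have a0 : 0 <= a := sqrtr_ge0 _.
rewrite -a2 -(ler_pM2r s0) mulrDl divfK ?gt_eqF //.
by nra.
Qed.

(** Telescoping: the factors are replaced one at a time, the others having modulus at most 1. *)
Lemma norm_prodB (I : finType) (a b : I -> C) :
  (forall i, `|a i| <= 1) -> (forall i, `|b i| <= 1) ->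
  `|\prod_i a i - \prod_i b i| <= \sum_i `|a i - b i|.
Proof.
move=> a1 b1.
suff [] : `|\prod_i a i - \prod_i b i| <= \sum_i `|a i - b i| /\ `|\prod_i b i| <= 1 by [].
elim: (index_enum I) => [|i r [IHd IHb]].
  by rewrite !big_nil subrr normr0 normr1 !lexx.
rewrite !big_cons; split; last by rewrite normrM mulr_ile1.
set A := \prod_(j <- r) a j in IHd *; set B := \prod_(j <- r) b j in IHd IHb *.
have -> : a i * A - b i * B = a i * (A - B) + (a i - b i) * B by ring.
apply: le_trans (ler_normD _ _) _; rewrite addrC !normrM.
apply: lerD; first by rewrite -[leRHS]mulr1 ler_wpM2l.
by apply: le_trans IHd; rewrite -[leRHS]mul1r ler_wpM2r.
Qed.

Variable Q : finType.
Implicit Types (T : {set Q}) (u w x : bits Q) (psi : ket Q).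

(** The mean over all strings x of the indicator of [bcut T x = u], that is 2^-|T| when u is
    supported on T. Being written as a mean, it makes the diagonal weights sum to 0 at once. *)
Definition fiber_ratio T u : R :=
  #|[pred x | bcut T x == u]|%:R / #|{: bits Q}|%:R.

Lemma fiber_ratio_itv T u : 0 <= fiber_ratio T u <= 1.
Proof.
have N0 : (0 < #|{: bits Q}|)%N by apply/card_gt0P; exists bzero.
rewrite divr_ge0 //= ler_pdivrMr ?ltr0n // mul1r ler_nat; exact: max_card.
Qed.

(* The entry of the reduced state of the maximally mixed state.                *)
Definition mixed T u w : C := ((w == bzero)%:R * fiber_ratio T u)%:C%C.

(* For u = u + w the reference is subtracted from every diagonal entry, using  *)
(* that the squared amplitudes sum to 1; this makes the deviation a homogeneous*)
(* form, hence its square linear in the second moment.                         *)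
Definition dev_weight T u w x : R :=
  (bcut T x == u)%:R - (w == bzero)%:R * fiber_ratio T u.

Definition deviation T u w psi : C :=
  \sum_x (dev_weight T u w x)%:C%C * (amp psi x * (amp psi (badd x w))^*).

Lemma dev_weight_le1 T u w x : `|dev_weight T u w x| <= 1.
Proof.
have /andP[c0 c1] := fiber_ratio_itv T u; rewrite ler_norml /dev_weight.
by case: (_ == u); case: (_ == bzero); rewrite ?mul1r ?mul0r /=; lra.
Qed.

Lemma pure_amp psi : pure psi -> \sum_x amp psi x * (amp psi x)^* = 1.
Proof.
move=> /matrixP /(_ 0 0); rewrite !mxE eqxx mulr1n => <-.
by rewrite sum_enum_rank; apply: eq_bigr => x _; rewrite !mxE mulrC.
Qed.

Lemma reduced_deviation T u w psi : pure psi ->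
  reduced T u w psi = mixed T u w + deviation T u w psi.
Proof.
move=> ppsi; rewrite /reduced /deviation /dev_weight.
under [in RHS]eq_bigr do rewrite rmorphB mulrBl /=.
rewrite big_split /= sumrN -mulr_sumr.
have -> : \sum_x ((bcut T x == u)%:R)%:C%C * (amp psi x * (amp psi (badd x w))^*) =
    \sum_(x | bcut T x == u) amp psi x * (amp psi (badd x w))^* :> C.
  rewrite [RHS]big_mkcond; apply: eq_bigr => x _.
  by case: ifP => _; rewrite ?rmorph1 ?mul1r // rmorph0 mul0r.
rewrite -/(mixed T u w) addrCA -[LHS]addr0; congr (_ + _).
rewrite /mixed; case: (w =P bzero) => [->|_]; last by rewrite mul0r rmorph0 mul0r subr0.
by under eq_bigr do rewrite badd0; rewrite pure_amp // mulr1 subrr.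
Qed.

Lemma reduced_le1 T u w psi : pure psi -> `|reduced T u w psi| <= 1.
Proof.
move=> ppsi; apply: le_trans (ler_norm_sum _ _ _) _.
apply: le_trans (_ : \sum_x `|amp psi x| * `|amp psi (badd x w)| <= _).
  rewrite big_mkcond /=; apply: ler_sum => x _; case: ifP => _; last by rewrite mulr_ge0.
  by rewrite normrM norm_conjC.
have n1 : \sum_x `|amp psi x| ^+ 2 = 1.
  by rewrite -(pure_amp ppsi); apply: eq_bigr => x _; rewrite normCK.
apply: cauchy_schwarz_unit => //; first by rewrite expr1n.
by rewrite -n1 [RHS](reindex_inj (@badd_inj _ w)).
Qed.

Lemma mixed_le1 T u w : `|mixed T u w| <= 1.
Proof.
have /andP[c0 c1] := fiber_ratio_itv T u; rewrite /mixed normc_def /= expr0n addr0 sqrtr_sqr.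
rewrite lecR ger0_norm; first by case: (_ == bzero); rewrite ?mul1r ?mul0r.
by case: (_ == bzero); rewrite ?mul1r ?mul0r.
Qed.

(** Both copies are shifted by w: one column is selected in each row, as in a permutation matrix. *)
Definition moment_shift w (i : 'I_#|{: bits ('I_2 * Q)%type}|) :=
  enum_rank (badd (enum_val i) [ffun p : 'I_2 * Q => w p.2]).

Definition moment_weight T u w (i : 'I_#|{: bits ('I_2 * Q)%type}|) : R :=
  dev_weight T u w (copy_bits (enum_val i) ord0) *
  dev_weight T u w (badd (copy_bits (enum_val i) ord_max) w).

Lemma moment_shift_inj w : injective (moment_shift w).
Proof. by move=> i j /enum_rank_inj /badd_inj /enum_val_inj. Qed.

Lemma moment_weight_le1 T u w i : `|moment_weight T u w i| <= 1.
Proof. by rewrite normrM mulr_ile1 ?dev_weight_le1. Qed.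

(** In the product of the deviation and its conjugate, the conjugate factor is reindexed by y -> y +
    w, which turns it into an entry of the second copy of the projector; this is why the second
    weight is evaluated at a shifted string. *)
Lemma sqn_deviation T u w psi :
  sqn (deviation T u w psi) = \sum_i moment_weight T u w i *
    complex.Re (copies 2 (projector psi) i (moment_shift w i)).
Proof.
pose a := dev_weight T u w.
pose F (j : 'I_2) x : C :=
  (a (if j == ord0 then x else badd x w))%:C%C * (amp psi x * (amp psi (badd x w))^*).
suff E : (sqn (deviation T u w psi))%:C%C = \sum_i (moment_weight T u w i)%:C%C *
    copies 2 (projector psi) i (moment_shift w i).
  have := congr1 (@complex.Re R) E; rewrite /= => ->.
  rewrite (raddf_sum (@complex.Re R : Rcomplex R -> R)) /=; apply: eq_bigr => i _.
  by case: (copies 2 _ _ _) => p q /=; rewrite mul0r subr0.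
(* The condition on the empty set is vacuous; it gives the sum the shape required by
   [sum_prod_copies]. *)
rewrite sum_enum_rank; transitivity (\sum_(X | bcut (finset.set0 : {set 'I_2 * Q}) X == bzero)
    \prod_(j < 2) F j (copy_bits X j)).
  rewrite sum_prod_copies big_ord_recl big_ord1 sqnE.
  have cond (j : 'I_2) x : (bcut (copy_set finset.set0 j) x == copy_bits bzero j).
    by apply/eqP/ffunP => q; rewrite bcutE copy_bitsE ffunE !inE.
  congr (_ * _); rewrite ?rmorph_sum /=.
    by apply: eq_big => [x|x _]; rewrite ?cond.
  rewrite (reindex_inj (@badd_inj _ w)) /=; apply: eq_big => [x|x _]; first by rewrite cond.
  rewrite !rmorphM /= conjCK baddK /F /=; rewrite conj_Creal ?complex_real //.
  by rewrite [_^* * _]mulrC.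
have all0 X : bcut (finset.set0 : {set 'I_2 * Q}) X == bzero.
  by apply/eqP/ffunP => q; rewrite bcutE ffunE inE.
apply: eq_big => [X|X _]; first by rewrite all0.
rewrite /moment_weight /moment_shift enum_rankK -/(coef _ _ _) coef_copies.
rewrite !big_ord_recl !big_ord0 !mulr1 !coef_projector rmorphM /= /F /=.
have shiftE (j : 'I_2) : copy_bits (badd X [ffun p => w p.2]) j = badd (copy_bits X j) w.
  by rewrite copy_bits_badd; congr badd; apply/ffunP => q; rewrite copy_bitsE ffunE.
have -> : lift ord0 ord0 = ord_max :> 'I_2 by apply: val_inj.
by rewrite !shiftE /a; ring.
Qed.

End Deviation.

Section OutputDeviation.
Variable R : realType.
Local Notation C := R[i].

Definition cone_bound (d k : nat) : nat := (2 * 2 ^ (2 ^ d * k))%N.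

(** B is the output probability computed with maximally mixed reduced states, fixed before psi. The
    exact formula is kept in the statement because the integrability of the output is read off from
    it. *)
Lemma output_deviation (Q : finType) t k (c : circuit R ('I_t * Q)%type k) z :
  exists (T : {set 'I_t * Q}) (K : bits ('I_t * Q)%type -> bits ('I_t * Q)%type -> C) (B : R),
  [/\ (#|T| <= 2 ^ circuit_depth c * k)%N,
      forall psi, output c (copies t (projector psi)) z =
        complex.Re (\sum_(w | bcut T w == w) \sum_(u | bcut T u == u)
           K w u * \prod_j reduced (copy_set T j) (copy_bits u j) (copy_bits w j) psi) &
      forall psi (s : R), pure psi -> 0 < s ->
        `|output c (copies t (projector psi)) z - B| <=
        (cone_bound (circuit_depth c) k)%:R *
        \sum_(w | bcut T w == w) \sum_(u | bcut T u == u) \sum_j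
          (s + sqn (deviation (copy_set T j) (copy_bits u j) (copy_bits w j) psi) / s)].
Proof.
have [T [K [cT K_le out]]] := output_reduced c z.
exists T, K, (complex.Re (\sum_(w | bcut T w == w) \sum_(u | bcut T u == u)
   K w u * \prod_j mixed R (copy_set T j) (copy_bits u j) (copy_bits w j))); split => // psi s ppsi s0.
rewrite out -(raddfB (@complex.Re R : Rcomplex R -> R)) /= -lecR.
apply: le_trans (normc_ge_Re _) _.
rewrite -sumrB rmorphM rmorph_nat rmorph_sum mulr_sumr.
apply: le_trans (ler_norm_sum _ _ _) _; apply: ler_sum => w _.
rewrite -sumrB rmorph_sum mulr_sumr.
apply: le_trans (ler_norm_sum _ _ _) _; apply: ler_sum => u _.
rewrite -mulrBr normrM rmorph_sum; apply: ler_pM => //.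
apply: le_trans (norm_prodB _ _) _ => [j|j|]; rewrite ?reduced_le1 ?mixed_le1 //.
apply: ler_sum => j _; rewrite (reduced_deviation _ _ _ ppsi) addrC addrA addNr add0r.
exact: norm_le_sqn.
Qed.

End OutputDeviation.

(** * Expectations *)

Section EssentiallyBounded.
Context d (T : measurableType d) (R : realType) (P : probability T R) (D : set T).
Local Notation C := R[i].
Hypotheses (mD : measurable D) (PD : P D = 1%E).

(* Measurable, and bounded on the set D of full measure: the Haar law is a     *)
(* measure on all vectors, where polynomials in the amplitudes are unbounded.  *)
Definition bmfun (f : T -> R) : Prop :=
  measurable_fun setT f /\ exists M : R, forall w, D w -> `|f w| <= M.

Local Notation Ex f := (\int[P]_(w in D) f w).

Lemma bmfun_integrable f : bmfun f -> P.-integrable D (EFin \o f).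
Proof.
move=> [mf [M fM]]; apply: measurable_bounded_integrable => //.
- by rewrite [X in (X < _)%E]PD ltry.
- exact: measurable_funTS.
- exists M; split => [|r Mr w Dw]; first by rewrite num_real.
  exact: le_trans (fM w Dw) (ltW Mr).
Qed.

Lemma expect_setT f : bmfun f -> \int[P]_w f w = Ex f.
Proof.
move=> [mf _]; rewrite [RHS]Rintegral_mkcond /Rintegral; congr fine.
apply: ae_eq_integral => //.
- exact/measurable_EFinP.
- apply/measurable_EFinP/(measurable_restrictT f mD).1.
  exact: measurable_funTS.
exists (~` D)%classic; split; first exact: measurableC.
  by rewrite [LHS](probability_setC P mD) [X in (_ - X)%E]PD subee.
move=> w /= /not_implyP[_ ne] Dw; apply: ne.
by rewrite patchE mem_set.
Qed.

Lemma expect_cst r : Ex (fun=> r) = r.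
Proof. by rewrite Rintegral_cst // [X in fine X]PD /= mulr1. Qed.

Lemma bmfun_cst r : bmfun (fun=> r).
Proof. by split; [exact: measurable_cst|exists `|r|]. Qed.

Lemma bmfunD f g : bmfun f -> bmfun g -> bmfun (fun w => f w + g w).
Proof.
move=> [mf [M fM]] [mg [M' gM]]; split; first exact: measurable_funD.
exists (M + M') => w Dw; apply: le_trans (ler_normD _ _) _.
by apply: lerD; [exact: fM|exact: gM].
Qed.

Lemma bmfunM f g : bmfun f -> bmfun g -> bmfun (fun w => f w * g w).
Proof.
move=> [mf [M fM]] [mg [M' gM]]; split; first exact: measurable_funM.
exists (M * M') => w Dw; rewrite normrM.
by apply: ler_pM => //; [exact: fM|exact: gM].
Qed.

Lemma bmfunZ r f : bmfun f -> bmfun (fun w => r * f w).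
Proof. exact: bmfunM (bmfun_cst r). Qed.

Lemma bmfunN f : bmfun f -> bmfun (fun w => - f w).
Proof.
move=> gf; rewrite (_ : (fun w => - f w) = (fun w => -1 * f w)); first exact: bmfunZ.
by apply/funext => w; rewrite mulN1r.
Qed.

Lemma bmfunB f g : bmfun f -> bmfun g -> bmfun (fun w => f w - g w).
Proof. by move=> gf gg; apply: bmfunD => //; apply: bmfunN. Qed.

Lemma bmfun_sum (I : Type) (r : seq I) (p : pred I) (f : I -> T -> R) :
  (forall i, bmfun (f i)) -> bmfun (fun w => \sum_(i <- r | p i) f i w).
Proof.
move=> gf; elim: r => [|i r IH].
  by rewrite (_ : (fun w => _) = fun=> 0); [exact: bmfun_cst|apply/funext => w; rewrite big_nil].
rewrite (_ : (fun w => _) = fun w => (if p i then f i w else 0) + \sum_(j <- r | p j) f j w); last first.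
  by apply/funext => w; rewrite big_cons; case: (p i); rewrite ?add0r.
by apply: bmfunD => //; case: (p i); [exact: gf|exact: bmfun_cst].
Qed.

Lemma expectD f g : bmfun f -> bmfun g -> Ex (fun w => f w + g w) = Ex f + Ex g.
Proof. by move=> gf gg; rewrite RintegralD //; exact: bmfun_integrable. Qed.

Lemma expectB f g : bmfun f -> bmfun g -> Ex (fun w => f w - g w) = Ex f - Ex g.
Proof. by move=> gf gg; rewrite RintegralB //; exact: bmfun_integrable. Qed.

Lemma expectZ r f : bmfun f -> Ex (fun w => r * f w) = r * Ex f.
Proof. by move=> gf; rewrite RintegralZl //; exact: bmfun_integrable. Qed.

Lemma expect_sum (I : Type) (r : seq I) (p : pred I) (f : I -> T -> R) :
  (forall i, bmfun (f i)) -> Ex (fun w => \sum_(i <- r | p i) f i w) = \sum_(i <- r | p i) Ex (f i).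
Proof.
move=> gf; elim: r => [|i r IH].
  by under eq_Rintegral do rewrite big_nil; rewrite big_nil expect_cst.
rewrite big_cons; case: ifP => pi; last first.
  by under eq_Rintegral do rewrite big_cons pi.
under eq_Rintegral do rewrite big_cons pi.
by rewrite expectD ?IH //; exact: bmfun_sum.
Qed.

Lemma le_expect f g : bmfun f -> bmfun g -> (forall w, D w -> f w <= g w) -> Ex f <= Ex g.
Proof. by move=> gf gg fg; apply: le_Rintegral => //; exact: bmfun_integrable. Qed.

Lemma eq_expect f g : (forall w, D w -> f w = g w) -> Ex f = Ex g.
Proof. by move=> fg; apply: eq_Rintegral => w /set_mem; exact: fg. Qed.

Definition cbmfun (f : T -> C) : Prop :=
  bmfun (fun w => complex.Re (f w)) /\ bmfun (fun w => complex.Im (f w)).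

Lemma cbmfun_cst (z : C) : cbmfun (fun=> z).
Proof. by split; exact: bmfun_cst. Qed.

Lemma cbmfunD f g : cbmfun f -> cbmfun g -> cbmfun (fun w => f w + g w).
Proof.
move=> [f1 f2] [g1 g2]; split.
  rewrite (_ : (fun w => _) = fun w => complex.Re (f w) + complex.Re (g w)); first exact: bmfunD.
  by apply/funext => w; case: (f w) (g w) => [? ?] [].
rewrite (_ : (fun w => _) = fun w => complex.Im (f w) + complex.Im (g w)); first exact: bmfunD.
by apply/funext => w; case: (f w) (g w) => [? ?] [].
Qed.

Lemma cbmfunM f g : cbmfun f -> cbmfun g -> cbmfun (fun w => f w * g w).
Proof.
move=> [f1 f2] [g1 g2]; split.
  rewrite (_ : (fun w => _) = fun w => complex.Re (f w) * complex.Re (g w) -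
      complex.Im (f w) * complex.Im (g w)); first by apply: bmfunB; exact: bmfunM.
  by apply/funext => w; case: (f w) (g w) => [? ?] [].
rewrite (_ : (fun w => _) = fun w => complex.Re (f w) * complex.Im (g w) +
    complex.Im (f w) * complex.Re (g w)); first by apply: bmfunD; exact: bmfunM.
by apply/funext => w; case: (f w) (g w) => [? ?] [].
Qed.

Lemma cbmfun_conj f : cbmfun f -> cbmfun (fun w => (f w)^*).
Proof.
move=> [f1 f2]; split.
  rewrite (_ : (fun w => _) = fun w => complex.Re (f w)) //.
  by apply/funext => w; case: (f w).
rewrite (_ : (fun w => _) = fun w => - complex.Im (f w)); first exact: bmfunN.
by apply/funext => w; case: (f w).
Qed.

Lemma cbmfun_sum (I : Type) (r : seq I) (p : pred I) (f : I -> T -> C) :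
  (forall i, cbmfun (f i)) -> cbmfun (fun w => \sum_(i <- r | p i) f i w).
Proof.
move=> gf; elim: r => [|i r IH].
  by rewrite (_ : (fun w => _) = fun=> 0); [exact: cbmfun_cst|apply/funext => w; rewrite big_nil].
rewrite (_ : (fun w => _) = fun w => (if p i then f i w else 0) + \sum_(j <- r | p j) f j w); last first.
  by apply/funext => w; rewrite big_cons; case: (p i); rewrite ?add0r.
by apply: cbmfunD => //; case: (p i); [exact: gf|exact: cbmfun_cst].
Qed.

Lemma cbmfun_prod (I : Type) (r : seq I) (f : I -> T -> C) :
  (forall i, cbmfun (f i)) -> cbmfun (fun w => \prod_(i <- r) f i w).
Proof.
move=> gf; elim: r => [|i r IH].
  by rewrite (_ : (fun w => _) = fun=> 1); [exact: cbmfun_cst|apply/funext => w; rewrite big_nil].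
rewrite (_ : (fun w => _) = fun w => f i w * \prod_(j <- r) f j w); last first.
  by apply/funext => w; rewrite big_cons.
by apply: cbmfunM.
Qed.

Lemma bmfun_sqn f : cbmfun f -> bmfun (fun w => sqn (f w)).
Proof. by move=> [f1 f2]; apply: bmfunD; rewrite /=; exact: bmfunM. Qed.

End EssentiallyBounded.

Section RandomKet.
Context d (T : measurableType d) (R : realType) (P : probability T R) (D : set T).
Local Notation C := R[i].
Local Notation ket Q := 'cV[C]_#|{: bits Q}|.
Hypotheses (mD : measurable D) (PD : P D = 1%E).
Variables (Q : finType) (psi : T -> ket Q).
Hypothesis psi_pure : forall w, D w -> pure (psi w).
Hypothesis psi_meas : forall x,
  measurable_fun setT (fun w => complex.Re (amp (psi w) x)) /\
  measurable_fun setT (fun w => complex.Im (amp (psi w) x)).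

Lemma pure_sqn (phi : ket Q) : pure phi -> \sum_x sqn (amp phi x) = 1.
Proof.
move=> /pure_amp E; apply: (@complexI R); rewrite rmorph_sum rmorph1 -E.
by apply: eq_bigr => x _; exact: sqnE.
Qed.

Lemma cbmfun_amp x : cbmfun D (fun w => amp (psi w) x).
Proof.
have b w : D w -> sqn (amp (psi w) x) <= 1.
  move=> /psi_pure /pure_sqn <-; rewrite (bigD1 x) //= lerDl.
  by apply: sumr_ge0 => y _; exact: sqn_ge0.
by split; (split; first by case: (psi_meas x)); exists 1 => w /b; rewrite /sqn => b1;
  rewrite ler_norml; apply/andP; split; nra.
Qed.

Lemma cbmfun_reduced S u v : cbmfun D (fun w => reduced S u v (psi w)).
Proof.
apply: cbmfun_sum => x; apply: cbmfunM; first exact: cbmfun_amp.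
by apply: cbmfun_conj; exact: cbmfun_amp.
Qed.

Lemma cbmfun_deviation S u v : cbmfun D (fun w => deviation S u v (psi w)).
Proof.
apply: cbmfun_sum => x; apply: cbmfunM; first exact: cbmfun_cst.
by apply: cbmfunM; [|apply: cbmfun_conj]; exact: cbmfun_amp.
Qed.

Lemma cbmfun_copies (i j : 'I_#|{: bits ('I_2 * Q)%type}|) :
  cbmfun D (fun w => copies 2 (projector (psi w)) i j).
Proof.
rewrite (_ : (fun w => _) = fun w => \prod_(l < 2)
  (amp (psi w) (copy_bits (enum_val i) l) * (amp (psi w) (copy_bits (enum_val j) l))^*)).
  apply: cbmfun_prod => l; apply: cbmfunM; [|apply: cbmfun_conj]; exact: cbmfun_amp.
apply/funext => w; rewrite -{1}(enum_valK i) -{1}(enum_valK j) -/(coef _ _ _) coef_copies.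
by apply: eq_bigr => l _; rewrite coef_projector.
Qed.

(** The mean square of a deviation is a linear functional of the second moment, the same one for
    every law. *)
Lemma expect_sqn_deviation S u v :
  \int[P]_(w in D) sqn (deviation S u v (psi w)) =
  \sum_i moment_weight R S u v i * complex.Re (second_moment P psi i (moment_shift v i)).
Proof.
under eq_Rintegral do rewrite sqn_deviation.
have gi i := (cbmfun_copies i (moment_shift v i)).1.
rewrite expect_sum // => [|i]; last by apply: bmfunZ.
apply: eq_bigr => i _; rewrite expectZ // mxE /= -(expect_setT mD PD) //.
Qed.

End RandomKet.

Section ExpectedOutput.
Variable R : realType.
Local Notation ket Q := 'cV[R[i]]_#|{: bits Q}|.

(** B is quantified before the probability space, so that the ensemble and the Haar law are compared
    with one and the same number. *)
Lemma expected_output_deviation (Q : finType) t k (c : circuit R ('I_t * Q)%type k)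
    (z : bits 'I_k) :
  exists B : R, forall d (T : measurableType d) (P : probability T R) (D : set T)
    (psi : T -> ket Q) (s eta : R),
  measurable D -> P D = 1%E -> (forall w, D w -> pure (psi w)) ->
  (forall x, measurable_fun setT (fun w => complex.Re (amp (psi w) x)) /\
             measurable_fun setT (fun w => complex.Im (amp (psi w) x))) ->
  0 < s -> 0 <= eta ->
  (forall S u v, bcut S u = u -> bcut S v = v ->
    \int[P]_(w in D) sqn (deviation S u v (psi w)) <= eta) ->
  `|expected_output P c psi z - B| <=
    (cone_bound (circuit_depth c) k * (4 ^ (2 ^ circuit_depth c * k) * t))%:R * (s + eta / s).
Proof.
have [U [K [B [cU out dev]]]] := output_deviation c z.
exists B => d T P D psi s eta mD PD ppsi mpsi s0 eta0 var.
have gout : bmfun D (fun w => output c (copies t (projector (psi w))) z).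
  rewrite (_ : (fun w => _) = fun w => complex.Re (\sum_(w0 | bcut U w0 == w0) \sum_(u | bcut U u == u)
       K w0 u * \prod_j reduced (copy_set U j) (copy_bits u j) (copy_bits w0 j) (psi w))).
    apply: (fun f (g : cbmfun D f) => g.1) _ _.
    apply: cbmfun_sum => v; apply: cbmfun_sum => u; apply: cbmfunM; first exact: cbmfun_cst.
    by apply: cbmfun_prod => j; exact: cbmfun_reduced.
  by apply/funext => w; exact: out.
pose dv v u j w := deviation (copy_set U j) (copy_bits u j) (copy_bits v j) (psi w).
have gdv v u j : bmfun D (fun w => sqn (dv v u j w)) by apply: bmfun_sqn; exact: cbmfun_deviation.
have gterm v u j : bmfun D (fun w => s + sqn (dv v u j w) / s).
  apply: bmfunD; first exact: bmfun_cst.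
  by rewrite (_ : (fun w => _) = fun w => s^-1 * sqn (dv v u j w)); [exact: bmfunZ|apply/funext => w; rewrite mulrC].
pose rhs w := (cone_bound (circuit_depth c) k)%:R *
  \sum_(v | bcut U v == v) \sum_(u | bcut U u == u) \sum_j (s + sqn (dv v u j w) / s).
have grhs : bmfun D rhs.
  by apply: bmfunZ; apply: bmfun_sum => v; apply: bmfun_sum => u; apply: bmfun_sum => j.
have rhs_le : \int[P]_(w in D) rhs w <=
    (cone_bound (circuit_depth c) k * (4 ^ (2 ^ circuit_depth c * k) * t))%:R * (s + eta / s).
  rewrite expectZ //; last by apply: bmfun_sum => v; apply: bmfun_sum => u; apply: bmfun_sum => j.
  rewrite natrM -mulrA; apply: ler_wpM2l => //.
  rewrite expect_sum //; last by move=> v; apply: bmfun_sum => u; apply: bmfun_sum => j.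
  have se0 : 0 <= s + eta / s by rewrite addr_ge0 ?divr_ge0 // ltW.
  apply: le_trans (_ : \sum_(v | bcut U v == v) \sum_(u | bcut U u == u) \sum_(j < t) (s + eta / s) <= _).
    apply: ler_sum => v /eqP vU; rewrite expect_sum //; last by move=> u; apply: bmfun_sum => j.
    apply: ler_sum => u /eqP uU; rewrite expect_sum //.
    apply: ler_sum => j _; rewrite expectD //; last 2 first.
    - exact: bmfun_cst.
    - by rewrite (_ : (fun w => _) = fun w => s^-1 * sqn (dv v u j w)); [exact: bmfunZ|apply/funext => w; rewrite mulrC].
    rewrite expect_cst // lerD2l.
    under eq_Rintegral do rewrite mulrC.
    rewrite expectZ // [leRHS]mulrC ler_wpM2l ?invr_ge0 ?(ltW s0) //.
    apply: (var (copy_set U j) (copy_bits u j) (copy_bits v j)).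
      by have /eqP := uU; rewrite bcut_copies => /forallP /(_ j) /eqP.
    by have /eqP := vU; rewrite bcut_copies => /forallP /(_ j) /eqP.
  (* There are 2^|U| choices for each of u and v, and t copies. *)
  rewrite !sumr_const card_ord card_bcut -!mulrnA -[leLHS]mulr_natl.
  apply: ler_wpM2r => //; rewrite ler_nat.
  have -> : (t * (2 ^ #|U| * 2 ^ #|U|) = 4 ^ #|U| * t)%N by rewrite -expnMn mulnC.
  by rewrite leq_mul2r leq_exp2l // cU orbT.
rewrite /expected_output (expect_setT mD PD gout) ler_norml; apply/andP; split.
- rewrite lerNl opprB -{1}(expect_cst mD PD B) -expectB //; last exact: bmfun_cst.
  apply: le_trans rhs_le; apply: le_expect => //; first by apply: bmfunB => //; exact: bmfun_cst.
  move=> w Dw; apply: le_trans (dev (psi w) s (ppsi w Dw) s0).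
  by rewrite -normrN opprB ler_norm.
- rewrite -{1}(expect_cst mD PD B) -expectB //; last exact: bmfun_cst.
  apply: le_trans rhs_le; apply: le_expect => //; first by apply: bmfunB => //; exact: bmfun_cst.
  by move=> w Dw; apply: le_trans (dev (psi w) s (ppsi w Dw) s0); rewrite ler_norm.
Qed.

End ExpectedOutput.

(** * Second moments of the Haar measure *)

Section Reflections.
Variable R : realType.
Local Notation C := R[i].
Variable Q : finType.
Implicit Types (x y z : bits Q).

(** The rank-one matrix A built on w is Hermitian with A^2 = s A, so 1 - c A is Hermitian with
    square 1 + (c^2 s - 2 c) A = 1. *)
Lemma householder_unitary n (w : 'cV[C]_n) (c s : C) : c^* = c -> c * s = 2 ->
  w^t* *m w = s%:M -> 1%:M - c *: (w *m w^t*) \is unitarymx.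
Proof.
move=> cr cs ws; apply/unitarymxP; set A := w *m w^t*.
have Ah : A^t* = A by rewrite /A trmx_mul map_mxM trmxCK.
have AA : A *m A = s *: A.
  by rewrite /A mulmxA -(mulmxA w) ws mul_mx_scalar scalemxAl.
have -> : (1%:M - c *: A)^t* = 1%:M - c *: A.
  rewrite -{2}Ah; apply/matrixP => i j; rewrite !mxE rmorphB rmorphM /= cr.
  by rewrite rmorph_nat eq_sym.
rewrite mulmxBl !mulmxBr !mul1mx mulmx1 -scalemxAl -scalemxAr AA !scalerA -mulrA cs.
by rewrite mulr_natr mulr2n scalerDl opprB addrK subrK.
Qed.

(** The reflection along a e_x + b e_y. Its instances swap two amplitudes, flip the sign of one, or
    mix two of them. *)
Lemma reflection (a b : R) x y : x != y -> a ^+ 2 + b ^+ 2 != 0 ->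
  exists2 U : 'M[C]_#|{: bits Q}|, U \is unitarymx &
    forall v z, amp (U *m v) z = amp v z -
      (2 / (a ^+ 2 + b ^+ 2) * (a * (z == x)%:R + b * (z == y)%:R))%:C%C *
      (a%:C%C * amp v x + b%:C%C * amp v y).
Proof.
move=> xy s0; set s := a ^+ 2 + b ^+ 2.
pose w : 'cV[C]_#|{: bits Q}| :=
  a%:C%C *: delta_mx (enum_rank x) 0 + b%:C%C *: delta_mx (enum_rank y) 0.
have realJ (r : R) : (r%:C%C)^* = r%:C%C :> C := conjc_real r.
have wJ : w^t* = a%:C%C *: delta_mx 0 (enum_rank x) + b%:C%C *: delta_mx 0 (enum_rank y).
  apply/matrixP => i j; rewrite !mxE rmorphD !rmorphM /= !rmorph_nat.
  by rewrite ![_ && (i == 0)]andbC !realJ.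
have wv (v : 'cV[C]_#|{: bits Q}|) :
    (w^t* *m v) 0 0 = a%:C%C * amp v x + b%:C%C * amp v y.
  by rewrite wJ mulmxDl -!scalemxAl -!rowE !mxE.
exists (1%:M - (2 / s)%:C%C *: (w *m w^t*)).
  apply: (@householder_unitary _ _ _ s%:C%C).
  - exact: realJ.
  - by rewrite -rmorphM /= divfK // rmorph_nat.
  - apply/matrixP => i j; rewrite !ord1 wv /amp !mxE !eqxx !(inj_eq enum_rank_inj).
    by rewrite (negbTE xy) eq_sym (negbTE xy) /= !mulr1 !mulr0 addr0 add0r mulr1n /s rmorphD !rmorphXn /= !expr2.
move=> v z; rewrite mulmxBl mul1mx -scalemxAl -mulmxA /amp !mxE; congr (_ - _).
rewrite big_ord1 wv !mxE !(inj_eq enum_rank_inj) !eqxx !andbT.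
by rewrite [in RHS]rmorphM rmorphD !rmorphM /= !rmorph_nat -!mulrA.
Qed.

End Reflections.

Section HaarMoments.
Variables (R : realType) (Q : finType) (haar : probability (qstate R Q) R).
Hypothesis haarP : is_haar haar.
Local Notation C := R[i].
Implicit Types (x y z u w : bits Q).

Definition sphere : set (qstate R Q) := [set v : qstate R Q | pure v]%classic.

Lemma amp_measurable x :
  measurable_fun setT (fun v : qstate R Q => complex.Re (amp v x)) /\
  measurable_fun setT (fun v : qstate R Q => complex.Im (amp v x)).
Proof.
split=> _ B mB; rewrite setTI; apply: sub_sigma_algebra; exists (enum_rank x), B;
  split => //; [by left|by right].
Qed.

Lemma pureE (v : qstate R Q) : pure v <-> \sum_x sqn (amp v x) = 1.
Proof.
split=> [|E]; first exact: pure_sqn.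
apply/matrixP => i j; rewrite !ord1 !mxE eqxx mulr1n -(rmorph1 (real_complex R)) -E rmorph_sum.
by rewrite sum_enum_rank; apply: eq_bigr => x _; rewrite !mxE mulrC; exact/esym/sqnE.
Qed.

Lemma sqn_amp_measurable x : measurable_fun setT (fun v : qstate R Q => sqn (amp v x)).
Proof.
by have [m1 m2] := amp_measurable x; apply: measurable_funD; exact: measurable_funX.
Qed.

Lemma measurable_sphere : measurable sphere.
Proof.
rewrite (_ : sphere = setT `&` (fun v => \sum_x sqn (amp v x)) @^-1` [set 1])%classic.
  have mf : measurable_fun setT (fun v : qstate R Q => \sum_x sqn (amp v x)).
    by apply: measurable_sum => x; exact: sqn_amp_measurable.
  by apply: mf => //; exact: measurable_set1.
by rewrite setTI; apply/seteqP; split => v /= /pureE.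
Qed.

Lemma haar_sphere : haar sphere = 1%E. Proof. by case: haarP. Qed.

Lemma pure_unitary (U : 'M[C]_#|{: bits Q}|) (v : 'cV[C]_#|{: bits Q}|) : U \is unitarymx ->
  pure (U *m v) <-> pure v.
Proof.
move=> /unitarymxP UU; rewrite /pure trmx_mul map_mxM mulmxA -(mulmxA _ _ U).
by rewrite (mulmx1C UU) mulmx1.
Qed.

Lemma mulmx_measurable (U : 'M[C]_#|{: bits Q}|) :
  measurable_fun setT (fun v : qstate R Q => (U *m v : qstate R Q)).
Proof.
have := @measurability _ _ (qstate R Q) (qstate R Q) setT (fun v => U *m v) (@ket_generators R Q) erefl.
apply => //.
have RE i : measurable_fun setT (fun v : qstate R Q => complex.Re ((U *m v) i 0)) /\
    measurable_fun setT (fun v : qstate R Q => complex.Im ((U *m v) i 0)).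
  (* Boundedness on the empty set is vacuous: here [cbmfun] only conveys the measurability of linear
     forms in the amplitudes. *)
  have [[m1 _] [m2 _]] : cbmfun (set0 : set (qstate R Q)) (fun v : qstate R Q => (U *m v) i 0);
    last by split.
  rewrite (_ : (fun v => _) = fun v : qstate R Q => \sum_j U i j * amp v (enum_val j)).
    apply: cbmfun_sum => j; apply: cbmfunM; first exact: cbmfun_cst.
    by have [m1 m2] := amp_measurable (enum_val j); split; split => //; exists 0.
  by apply/funext => v; rewrite mxE; apply: eq_bigr => j _; rewrite /amp enum_valK.
move=> _ [_ [i [B [mB [] ->]]] <-]; have [m1 m2] := RE i.
- by have := m1 measurableT _ mB.
- by have := m2 measurableT _ mB.
Qed.

Local Notation Ex f := (\int[haar]_(v in sphere) f v).
Local Notation bmfun := (@bmfun _ _ R sphere).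

(** Change of variables along v -> U v, which preserves both the law and the sphere. *)
Lemma haar_invariant (U : 'M[C]_#|{: bits Q}|) (f : qstate R Q -> R) :
  U \is unitarymx -> bmfun f -> Ex (fun v => f (U *m v)) = Ex f.
Proof.
move=> Uu gf; pose phi := fun v : qstate R Q => (U *m v : qstate R Q).
have mphi : measurable_fun setT phi := mulmx_measurable U.
have pre : (phi @^-1` sphere)%classic = sphere.
  by apply/seteqP; split => v /=; rewrite /sphere /phi /= pure_unitary.
have gfU : bmfun (f \o phi).
  have [mf [M fM]] := gf; split; first exact: measurableT_comp.
  by exists M => v vS; apply: fM; apply/pure_unitary.
rewrite /Rintegral; congr fine.
have := @integral_pushforward _ _ _ _ R phi mphi haar sphere (EFin \o f).
rewrite pre => <- //.
- apply: eq_measure_integral => A mA _; rewrite /pushforward.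
  by have [_ inv] := haarP; exact: inv.
- by apply/measurable_EFinP; case: gf.
- exact: (bmfun_integrable measurable_sphere haar_sphere gfU).
- exact: measurable_sphere.
Qed.

Let mS := measurable_sphere.
Let HS := haar_sphere.

Lemma sphere_cbmfun_amp x : cbmfun sphere (fun v : qstate R Q => amp v x).
Proof. exact: (@cbmfun_amp _ (qstate R Q) R sphere Q (fun v => v) (fun v pv => pv) amp_measurable x). Qed.

Lemma bmfun_sqn_amp x : bmfun (fun v => sqn (amp v x)).
Proof. exact/bmfun_sqn/sphere_cbmfun_amp. Qed.

Definition moment x y : R := Ex (fun v => sqn (amp v x) * sqn (amp v y)).

Lemma bmfun_moment x y : bmfun (fun v => sqn (amp v x) * sqn (amp v y)).
Proof. by apply: bmfunM; exact: bmfun_sqn_amp. Qed.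

Lemma momentC x y : moment x y = moment y x.
Proof. by apply: eq_expect => v _; rewrite mulrC. Qed.

Lemma moment_ge0 x y : 0 <= moment x y.
Proof. by apply: Rintegral_ge0 => v _; rewrite mulr_ge0 ?sqn_ge0. Qed.

Lemma swap_unitary x y : x != y -> exists2 U : 'M[C]_#|{: bits Q}|, U \is unitarymx &
  forall v, [/\ amp (U *m v) x = amp v y, amp (U *m v) y = amp v x &
    forall z, z != x -> z != y -> amp (U *m v) z = amp v z].
Proof.
move=> xy; have e2 : 1 ^+ 2 + (-1) ^+ 2 = 2 :> R by rewrite sqrrN expr1n -mulr2n.
have [|U Uu Uv] := @reflection R Q 1 (-1) x y xy; first by rewrite e2 pnatr_eq0.
exists U => // v; split=> [||z zx zy]; rewrite Uv e2.
- rewrite eqxx (negbTE xy) mulr0 addr0 mulr1 mulr1 divff ?pnatr_eq0 //.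
  by rewrite !rmorph1 rmorphN1 !mul1r mulN1r opprB addrC subrK.
- rewrite eqxx eq_sym (negbTE xy) mulr0 add0r mulr1 mulrN1 divff ?pnatr_eq0 //.
  by rewrite rmorph1 rmorphN1 !mulN1r mul1r opprK addrC subrK.
- by rewrite (negbTE zx) (negbTE zy) !mulr0 addr0 mulr0 rmorph0 mul0r subr0.
Qed.

Lemma moment_swap x y y' : x != y -> x != y' -> moment x y = moment x y'.
Proof.
move=> xy xy'; have [->//|yy'] := eqVneq y y'.
have [U Uu Uv] := swap_unitary yy'.
rewrite /moment -(haar_invariant Uu (bmfun_moment x y)); apply: eq_expect => v _.
by have [-> _ ->] := Uv v.
Qed.

Lemma moment_eq x y x' y' : x != y -> x' != y' -> moment x y = moment x' y'.
Proof.
move=> xy xy'; have [xy2|xy2] := eqVneq x y'.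
  rewrite -xy2 in xy' *; rewrite (momentC x') ; apply: moment_swap => //.
  by rewrite eq_sym.
by rewrite (moment_swap xy xy2) momentC (@moment_swap y' x x') // 1?eq_sym // momentC.
Qed.

Lemma moment_diag x y : moment x x = moment y y.
Proof.
have [->//|xy] := eqVneq x y; have [U Uu Uv] := swap_unitary xy.
rewrite /moment -(haar_invariant Uu (bmfun_moment x x)); apply: eq_expect => v _.
by have [-> _ _] := Uv v.
Qed.

(** The N (N - 1) off-diagonal moments are equal, the diagonal ones are nonnegative, and all of them
    sum to 1 because the squared amplitudes do. *)
Lemma moment_off_le x y : x != y ->
  moment x y <= 1 / (#|{: bits Q}|%:R * (#|{: bits Q}|%:R - 1)).
Proof.
move=> xy; set N := #|{: bits Q}|.
have N1 : 1 < N%:R :> R.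
  rewrite ltr1n /N (cardD1 x) (cardD1 y) !inE eq_sym xy /=; lia.
have s1 : \sum_x' \sum_y' moment x' y' = 1.
  rewrite -[RHS](expect_cst mS HS 1).
  transitivity (Ex (fun v => \sum_x' \sum_y' sqn (amp v x') * sqn (amp v y'))); last first.
    apply: eq_expect => v /pureE v1; under eq_bigr do rewrite -mulr_sumr v1 mulr1.
    by rewrite v1.
  rewrite (expect_sum mS HS) => [|x']; last by apply: bmfun_sum => y'; exact: bmfun_moment.
  apply: eq_bigr => x' _; rewrite (expect_sum mS HS) // => y'; exact: bmfun_moment.
have N0 : 0 < N%:R :> R by rewrite (lt_trans _ N1).
have NN : 0 < N%:R * (N%:R - 1) :> R by rewrite mulr_gt0 ?subr_gt0.
rewrite ler_pdivlMr // -[leRHS]s1.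
have -> : moment x y * (N%:R * (N%:R - 1)) = \sum_(x' : bits Q) \sum_(y' | y' != x') moment x y.
  under eq_bigr do rewrite sumr_const.
  have cardN x' : #|[pred y' | y' != x']| = N.-1 by rewrite cardC1.
  rewrite (eq_bigr (fun=> moment x y *+ N.-1)) => [|x' _]; last by rewrite -(cardN x').
  rewrite sumr_const -[RHS]mulr_natr -[moment x y *+ _]mulr_natr -/N.
  rewrite (_ : N.-1%:R = N%:R - 1); first by ring.
  by rewrite -subn1 natrB // -(ltr_nat R).
apply: ler_sum => x' _; rewrite [leRHS](bigD1 x') //= -[leLHS]add0r.
apply: lerD; first exact: moment_ge0.
by apply: ler_sum => y' y'x'; rewrite (@moment_eq x y x' y') // eq_sym.
Qed.

Lemma sqn_realM (r : R) (z : C) : sqn (r%:C%C * z) = r ^+ 2 * sqn z.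
Proof. by case: z => p q; rewrite /sqn /= !mul0r subr0 addr0; ring. Qed.

Lemma moment_diag_average (U V : 'M[C]_#|{: bits Q}|) (a b c : R) x y :
  U \is unitarymx -> V \is unitarymx ->
  (forall v, sqn (amp (U *m v) x) ^+ 2 + sqn (amp (V *m v) x) ^+ 2 <=
    a * sqn (amp v x) ^+ 2 + b * sqn (amp v y) ^+ 2 + c * (sqn (amp v x) * sqn (amp v y))) ->
  moment x x + moment x x <= a * moment x x + b * moment y y + c * moment x y.
Proof.
move=> Uu Vu le; rewrite {1}/moment -(haar_invariant Uu (bmfun_moment x x)).
rewrite {1}/moment -(haar_invariant Vu (bmfun_moment x x)).
have gU W : W \is unitarymx -> bmfun (fun v => sqn (amp (W *m v) x) * sqn (amp (W *m v) x)).
  move=> Wu; have [mf [M fM]] := bmfun_moment x x; split.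
    exact: (measurableT_comp mf (mulmx_measurable W)).
  by exists M => v vS; apply: (fM (W *m v)); apply/pure_unitary.
have g1 := gU _ Uu; have g2 := gU _ Vu; have gm x' y' := bmfun_moment x' y'.
have ga := bmfunZ a (gm x x); have gb := bmfunZ b (gm y y); have gc := bmfunZ c (gm x y).
rewrite -(expectD mS HS g1 g2) /moment -(expectZ mS HS a (gm x x)).
rewrite -(expectZ mS HS b (gm y y)) -(expectZ mS HS c (gm x y)).
rewrite -(expectD mS HS ga gb) -(expectD mS HS (bmfunD ga gb) gc).
apply: (le_expect mS HS (bmfunD g1 g2) (bmfunD (bmfunD ga gb) gc)) => v _.
by have := le v; rewrite !expr2.
Qed.

(* Averaging the rotations by the angles of cosine 3/5 cancels the odd cross   *)
(* terms, the even one being controlled by Cauchy-Schwarz.                     *)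
Lemma moment_diag_le x y : x != y -> moment x x <= 3 * moment x y.
Proof.
move=> xy.
(* The reflection along the vector with coordinates 1 and 2 [e] sends v_x to (3 v_x - 4 [e] v_y) /
   5, where [e] is a sign. *)
have rot (e : R) : e ^+ 2 = 1 -> exists2 U : 'M[C]_#|{: bits Q}|, U \is unitarymx &
    forall v, amp (U *m v) x = (5^-1)%:C%C * (3%:C%C * amp v x - (e * 4)%:C%C * amp v y).
  move=> e1; have e0 : 1 ^+ 2 + (e * 2) ^+ 2 = 5 :> R by rewrite exprMn e1; ring.
  have [|U Uu Uv] := @reflection R Q 1 (e * 2) x y xy; first by rewrite e0 pnatr_eq0.
  exists U => // v; rewrite Uv e0 eqxx (negbTE xy).
  case: (amp v x) (amp v y) => [p q] [p' q']; apply/eqP; rewrite eq_complex /=.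
  by apply/andP; split; apply/eqP; field.
have [U Uu Uv] := rot 1 (expr1n _ _).
have [|V Vu Vv] := rot (-1); first by rewrite sqrrN expr1n.
(* With P = |v_x|^2, Q = |v_y|^2 and r the real part of v_x times the conjugate of v_y, the two
   fourth powers add up to (162 P^2 + 512 Q^2 + 576 P Q + 1152 r^2) / 625, and r^2 <= P Q yields
   1728 = 576 + 1152. The diagonal moments being equal, 576 times [moment x x] is at most 1728 times
   [moment x y]. *)
have le : moment x x + moment x x <=
    (162 / 625) * moment x x + (512 / 625) * moment y y + (1728 / 625) * moment x y.
  apply: (moment_diag_average Uu Vu) => v; rewrite Uv Vv !sqn_realM.
  case: (amp v x) (amp v y) => [p q] [p' q']; rewrite /sqn /= !mul0r !subr0 !addr0.
  have c : (p * p' + q * q') ^+ 2 <= (p ^+ 2 + q ^+ 2) * (p' ^+ 2 + q' ^+ 2).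
    rewrite -subr_ge0 (_ : _ - _ = (p * q' - q * p') ^+ 2); [exact: sqr_ge0|ring].
  rewrite -subr_ge0 (_ : _ - _ = (1152 / 625) *
      ((p ^+ 2 + q ^+ 2) * (p' ^+ 2 + q' ^+ 2) - (p * p' + q * q') ^+ 2)); last by field.
  by apply: mulr_ge0; [lra|rewrite subr_ge0].
by rewrite (moment_diag y x) in le; lra.
Qed.

Lemma flip_unitary x y : x != y -> exists2 U : 'M[C]_#|{: bits Q}|, U \is unitarymx &
  forall v, amp (U *m v) x = - amp v x /\ forall z, z != x -> amp (U *m v) z = amp v z.
Proof.
move=> xy; have e1 : 1 ^+ 2 + 0 ^+ 2 = 1 :> R by rewrite expr1n expr0n addr0.
have [|U Uu Uv] := @reflection R Q 1 0 x y xy; first by rewrite e1 oner_eq0.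
exists U => // v; split=> [|z zx]; rewrite Uv e1 !mul0r !addr0.
  by rewrite eqxx !mulr1 divr1 mul1r rmorph_nat mulr_natl mulr2n opprD addrA subrr sub0r.
by rewrite (negbTE zx) !mulr0 mul0r subr0.
Qed.

(** Flipping the sign of the amplitude x, which occurs exactly once, negates the expectation. *)
Lemma expect_odd_eq0 x y a b c : x != y -> a != x -> b != x -> c != x ->
  Ex (fun v => complex.Re (amp v x * (amp v a)^* * (amp v b)^* * amp v c)) = 0.
Proof.
move=> xy ax bx cx; set f := fun v : qstate R Q => _.
have gf : bmfun f.
  apply: (fun g (h : cbmfun sphere g) => h.1) (fun v => amp v x * (amp v a)^* * (amp v b)^* * amp v c) _.
  by do !apply: cbmfunM; try apply: cbmfun_conj; exact: sphere_cbmfun_amp.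
have [U Uu Uv] := flip_unitary xy.
have E : Ex f = Ex (fun v => -1 * f v).
  rewrite -(haar_invariant Uu gf); apply: eq_expect => v _; rewrite /f.
  have [-> Uz] := Uv v; rewrite !Uz // !mulNr.
  by rewrite (raddfN (@complex.Re R : Rcomplex R -> R)) mul1r.
by move: E; rewrite (expectZ mS HS _ gf); lra.
Qed.

(** In the expanded square, the off-diagonal terms cancel: for w = 0 because the weights sum to 0
    and the off-diagonal moments are equal, for w <> 0 by sign flips. At most N terms of order 1 /
    N^2 remain. *)
Lemma haar_deviation S u w : (1 < #|{: bits Q}|)%N -> bcut S u = u -> bcut S w = w ->
  Ex (fun v => sqn (deviation S u w v)) <= 4 / #|{: bits Q}|%:R.
Proof.
move=> N_gt1 uS wS; set N := #|{: bits Q}| in N_gt1 *.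
have N2 : 2 <= N%:R :> R by rewrite ler_nat.
have [x0 [y0 xy0]] : exists x y : bits Q, x != y.
  have /card_gt0P[x _] : (0 < N)%N by lia.
  have : (0 < #|predC1 x|)%N by rewrite cardC1 -/N; lia.
  by case/card_gt0P => y; rewrite !inE eq_sym; exists x, y.
pose p := moment x0 y0; pose q := moment x0 x0.
have p_le : p * N%:R <= 1 / (N%:R - 1).
  have := moment_off_le xy0; rewrite -/p -/N !div1r invfM => h.
  rewrite -ler_pdivlMr; last lra.
  by rewrite mulrC.
have p0 : 0 <= p := moment_ge0 _ _.
have inv_le : 1 / (N%:R - 1) <= 2 / N%:R :> R.
  rewrite ler_pdivrMr; last lra.
  rewrite mulrAC ler_pdivlMr; last lra.
  by lra.
pose a := dev_weight R S u w.
have [w0|w_neq0] := eqVneq w bzero.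
  have a_sum : \sum_x a x = 0.
    rewrite /a /dev_weight w0 eqxx mul1r big_split /= sumr_const.
    have -> : \sum_x (bcut S x == u)%:R = #|[pred x | bcut S x == u]|%:R :> R.
      by rewrite -sum1_card natr_sum [RHS]big_mkcond; apply: eq_bigr => x _; rewrite inE; case: ifP.
    rewrite -[X in _ + X]mulr_natr mulNr /fiber_ratio divfK ?subrr // gt_eqF //.
    by rewrite ltr0n -/N; lia.
  have -> : Ex (fun v => sqn (deviation S u w v)) = \sum_x \sum_y a x * a y * moment x y.
    transitivity (Ex (fun v => \sum_x \sum_y a x * a y * (sqn (amp v x) * sqn (amp v y)))).
      apply: eq_expect => v _.
      have -> : deviation S u w v = (\sum_x a x * sqn (amp v x))%:C%C.
        rewrite /deviation rmorph_sum; apply: eq_bigr => x _ /=.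
        by rewrite w0 badd0 rmorphM /= sqnE /a w0.
      rewrite /sqn /= expr0n addr0 expr2 mulr_suml; apply: eq_bigr => x _.
      by rewrite mulr_sumr; apply: eq_bigr => y _; ring.
    rewrite (expect_sum mS HS) => [|x]; last by apply: bmfun_sum => y; apply/bmfunZ/bmfun_moment.
    apply: eq_bigr => x _; rewrite (expect_sum mS HS) => [|y]; last by apply/bmfunZ/bmfun_moment.
    by apply: eq_bigr => y _; rewrite (expectZ mS HS _ (bmfun_moment x y)).
  (* The moment matrix is q on the diagonal and p off it; its constant part p contributes p times
     the square of the sum of the weights, which is 0. *)
  have -> : \sum_x \sum_y a x * a y * moment x y = (q - p) * \sum_x a x ^+ 2.
    rewrite mulr_sumr; apply: eq_bigr => x _.
    rewrite (bigD1 x) //= (moment_diag x x0) -/q.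
    rewrite (eq_bigr (fun y => a x * p * a y)) => [|y yx]; last first.
      by rewrite (@moment_eq x y x0 y0) // 1?eq_sym //; rewrite -/p; ring.
    have ay : \sum_(y | y != x) a y = - a x.
      by have := a_sum; rewrite (bigD1 x) //= => /eqP; rewrite addr_eq0 => /eqP ->; rewrite opprK.
    by rewrite -mulr_sumr ay; ring.
  have q_le : q <= 3 * p by exact: moment_diag_le.
  have a2 : \sum_x a x ^+ 2 <= N%:R.
    rewrite -[leRHS]mulr_natl mulr1 -sumr_const; apply: ler_sum => x _.
    by rewrite -real_normK ?num_real // expr_le1 // dev_weight_le1.
  have a20 : 0 <= \sum_x a x ^+ 2 by apply: sumr_ge0 => x _; exact: sqr_ge0.
  apply: le_trans (_ : 2 * (p * N%:R) <= _).
    apply: le_trans (_ : 2 * p * \sum_x a x ^+ 2 <= _); first by apply: ler_wpM2r => //; lra.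
    by rewrite -mulrA ler_wpM2l // ler_wpM2l.
  by have := le_trans p_le inv_le; rewrite (_ : 4 / N%:R = 2 * (2 / N%:R)); [lra|ring].
pose g x y (v : qstate R Q) := complex.Re (amp v x * (amp v (badd x w))^* *
  (amp v y)^* * amp v (badd y w)).
have gg x y : bmfun (g x y).
  apply: (fun f (h : cbmfun sphere f) => h.1) (fun v => amp v x * (amp v (badd x w))^* * (amp v y)^* * amp v (badd y w)) _.
  by do !apply: cbmfunM; try apply: cbmfun_conj; exact: sphere_cbmfun_amp.
have aE x : a x = (bcut S x == u)%:R.
  by rewrite /a /dev_weight (negbTE w_neq0) mul0r subr0.
have -> : Ex (fun v => sqn (deviation S u w v)) = \sum_x \sum_y a x * a y * Ex (g x y).
  transitivity (Ex (fun v => \sum_x \sum_y a x * a y * g x y v)).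
    apply: eq_expect => v _.
    have -> (z : C) : sqn z = complex.Re (z * z^*) by rewrite -sqnE.
    rewrite /deviation rmorph_sum mulr_suml.
    rewrite (raddf_sum (@complex.Re R : Rcomplex R -> R)) /=; apply: eq_bigr => x _.
    rewrite mulr_sumr (raddf_sum (@complex.Re R : Rcomplex R -> R)) /=; apply: eq_bigr => y _.
    rewrite !rmorphM /= conjCK (conjc_real (dev_weight R S u w y) : (_%:C%C)^* = _) -/(a x) -/(a y).
    rewrite (_ : _ * _ = (a x * a y)%:C%C * (amp v x * (amp v (badd x w))^* * (amp v y)^* * amp v (badd y w))).
      by rewrite /g; case: (_ * amp v (badd y w)) => ? ? /=; rewrite mul0r subr0.
    by rewrite rmorphM /=; ring.
  rewrite (expect_sum mS HS) => [|x]; last by apply: bmfun_sum => y; apply/bmfunZ/gg.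
  apply: eq_bigr => x _; rewrite (expect_sum mS HS) => [|y]; last by apply/bmfunZ/gg.
  by apply: eq_bigr => y _; rewrite (expectZ mS HS _ (gg x y)).
apply: le_trans (_ : \sum_(x : bits Q) p <= _); last first.
  rewrite sumr_const -[leLHS]mulr_natr -/N; apply: le_trans p_le _; apply: le_trans inv_le _.
  by rewrite ler_pM2r ?invr_gt0; lra.
apply: ler_sum => x _; rewrite (bigD1 x) //= big1 => [|y yx].
  have xw : x != badd x w by rewrite eq_sym badd_eqr.
  have -> : Ex (g x x) = p.
    rewrite /p -(moment_eq xw xy0); apply: eq_expect => v _; rewrite /g.
    by case: (amp v x) (amp v (badd x w)) => [c e] [c' e']; rewrite /sqn /=; ring.
  rewrite addr0 aE; case: (_ == u); rewrite ?mulr1 ?mul1r ?mul0r //.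
(* Nonzero weights make x and y both restrict to u on S, so y + w = x would force w = 0. Hence, for
   y <> x, the amplitude x occurs only once and the term vanishes. *)
rewrite !aE; have [xu|_] := eqVneq (bcut S x) u; last by rewrite !mul0r.
have [yu|_] := eqVneq (bcut S y) u; last by rewrite mulr0 mul0r.
rewrite /g (@expect_odd_eq0 x y) ?mulr0 // 1?eq_sym // ?badd_eqr // 1?eq_sym ?badd_eqr //.
apply: contra_neq w_neq0 => yx'.
by have := congr1 (bcut S) yx'; rewrite bcut_badd yu wS xu => /eqP; rewrite badd_eqr => /eqP.
Qed.

End HaarMoments.

(** * Ensembles and asymptotics *)

Section Ensembles.
Variable R : realType.
Local Notation C := R[i].

Lemma trace_norm_ge0 n (M : 'M[C]_n) : 0 <= trace_norm M.
Proof.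
rewrite -lecR; apply: le_trans (trace_norm_duality M (b := fun=> 0) (p := id) _ _) => //.
  exact: normr_ge0.
by move=> i; rewrite normr0 ler01.
Qed.

Lemma nat_measurable (f : nat -> R) : measurable_fun setT f.
Proof. by []. Qed.

Section Design.
Variables (Q : finType) (haar : probability (qstate R Q) R) (E : ensemble R Q) (eps : R).
Hypotheses (haarP : is_haar haar) (E_design : approx_2design haar E eps).
Hypothesis N_gt1 : (1 < #|{: bits Q}|)%N.

(** The ensemble and Haar values differ by the pairing of the difference of second moments with a
    permutation matrix of weights at most 1 in modulus, which duality bounds by eps. *)
Lemma ensemble_deviation S u w : bcut S u = u -> bcut S w = w ->
  \int[ens_law E]_(i in setT) sqn (deviation S u w (ens_state E i)) <= 4 / #|{: bits Q}|%:R + eps.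
Proof.
move=> uS wS; have := haar_deviation haarP N_gt1 uS wS.
rewrite (expect_sqn_deviation (@measurable_sphere R Q) (haar_sphere haarP) (psi := fun v => v)) //;
  last exact: amp_measurable.
rewrite (expect_sqn_deviation measurableT (probability_setT (ens_law E))) //;
  last by move=> i _; exact: ens_pure.
move=> hle; rewrite -lerBlDr; apply: le_trans hle.
rewrite lerBlDl -lerBlDr -sumrB; apply: le_trans E_design.
rewrite -lecR; apply: le_trans (trace_norm_duality _ (b := fun i => (moment_weight R S u w i)%:C%C)
    (@moment_shift_inj Q w) _) => [|i]; last first.
  by rewrite normc_def /= expr0n addr0 sqrtr_sqr lecR moment_weight_le1.
apply: le_trans (normc_ge_Re _); rewrite lecR; apply: le_trans (ler_norm _).
rewrite (raddf_sum (@complex.Re R : Rcomplex R -> R)) /=; apply: ler_sum => i _.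
have subE (A B : 'M[C]_#|{: bits ('I_2 * Q)%type}|) j l : (A - B) j l = A j l - B j l.
  by rewrite !mxE.
rewrite subE.
case: (second_moment (ens_law E) _ _ _) (second_moment haar _ _ _) => [p q] [p' q'] /=.
by rewrite mul0r subr0 mulrBr.
Qed.

(** Triangle inequality through the common reference B of each outcome; the factor 1/2 absorbs the
    two errors, and 2^k counts the outcomes. *)
Lemma total_variation_le t k (c : circuit R ('I_t * Q)%type k) (s : R) : 0 < s ->
  Defs.total_variation (expected_output (ens_law E) c (ens_state E))
                  (expected_output haar c (fun v : qstate R Q => v)) <=
  (2 ^ k * (cone_bound (circuit_depth c) k * (4 ^ (2 ^ circuit_depth c * k) * t)))%:R *
    (s + (4 / #|{: bits Q}|%:R + eps) / s).
Proof.
move=> s0; set eta := 4 / _ + eps.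
have N0 : 0 <= 4 / #|{: bits Q}|%:R :> R by rewrite divr_ge0.
have eps0 : 0 <= eps := le_trans (trace_norm_ge0 _) E_design.
have eta0 : 0 <= eta by rewrite addr_ge0.
rewrite /Defs.total_variation natrM -mulrA; set b := (_ * (s + _)).
have le z : `|expected_output (ens_law E) c (ens_state E) z -
    expected_output haar c (fun v : qstate R Q => v) z| <= b + b.
  have [B dev] := expected_output_deviation c z.
  apply: le_trans (ler_distD B _ _) _; apply: lerD.
    apply: dev measurableT (probability_setT (ens_law E)) _ _ s0 eta0 _.
    - by move=> i _; exact: ens_pure.
    - by move=> x; split; exact: nat_measurable.
    - exact: ensemble_deviation.
  rewrite distrC.
  apply: dev (@measurable_sphere R Q) (haar_sphere haarP) _ _ s0 eta0 _ => //.
  - exact: amp_measurable.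
  - move=> S u w uS wS; apply: le_trans (haar_deviation haarP N_gt1 uS wS) _.
    by rewrite lerDl.
apply: le_trans (ler_wpM2l _ (ler_sum _ (fun z _ => le z))) _; first by rewrite invr_ge0.
by rewrite sumr_const card_bits card_ord -[X in _ * X]mulr_natr; lra.
Qed.

End Design.
End Ensembles.

(** * Asymptotic estimates *)

Section Asymptotics.
Local Open Scope classical_set_scope.
Variable R : realType.

(** The term of degree b + 1 of the exponential series, K n^(b+1), exceeds a n^b once n >= a / K. *)
Lemma poly_le_powR (g : R) (a b : nat) : 0 < g ->
  \forall n \near \oo, (a * n ^ b)%:R <= 2 `^ (g * n%:R) :> R.
Proof.
move=> g0; set h := g * ln 2.
have h0 : 0 < h by rewrite mulr_gt0 // ln_gt0 // ltr1n.
pose K := h ^+ b.+1 / (b.+1)`!%:R.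
have K0 : 0 < K by rewrite divr_gt0 ?exprn_gt0 // ltr0n fact_gt0.
near=> n.
have nK : a%:R / K <= n%:R by near: n; exact: nbhs_infty_ger.
rewrite /powR pnatr_eq0 /= mulrAC -/h.
apply: le_trans (expR_ge1Dxn b _); last by rewrite mulr_ge0 // ltW.
apply: le_trans (_ : K * n%:R ^+ b.+1 <= _); last first.
  by rewrite exprMn mulrAC lerDr.
rewrite natrM natrX exprS mulrA ler_wpM2r ?exprn_ge0 //.
by rewrite -ler_pdivrMl // mulrC.
Unshelve. all: by end_near. Qed.

Lemma littleo_div_log_le (f : nat -> R) (e : R) : 0 < e ->
  f =o_\oo (fun n : nat => n%:R / log2 n%:R : R) -> \forall n \near \oo, f n <= e * n%:R.
Proof.
move=> e0 /eqoP /(_ e e0) fo; near=> n.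
have n2 : 2 <= n%:R :> R by near: n; exact: nbhs_infty_ger.
have l2 : 0 < ln 2 :> R by rewrite ln_gt0 // ltr1n.
have lg1 : 1 <= log2 n%:R :> R.
  by rewrite /log2 ler_pdivlMr // mul1r ler_ln // posrE // (lt_le_trans _ n2).
have : `|f n| <= e * `|n%:R / log2 n%:R| by near: n; exact: fo.
move=> fn; apply: le_trans (ler_norm _) _; apply: le_trans fn _.
rewrite ler_pM2l // ger0_norm; last by rewrite divr_ge0 // (le_trans _ lg1).
by rewrite ler_pdivrMr ?(lt_le_trans _ lg1) // ler_peMr.
Unshelve. all: by end_near. Qed.

(** With m = 2^d k >= k, the factors are at most 2^m, 2 * 2^m and 4^m t, whose product is 2 t 2^(4
    m). *)
Lemma cone_factor_le (d d' k n t : nat) (e : R) : (d' <= d)%N ->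
  (2 ^ d * k)%:R <= e * n%:R ->
  (2 ^ k * (cone_bound d' k * (4 ^ (2 ^ d' * k) * t)))%:R <= 2 `^ (4 * e * n%:R) * (2 * t)%:R :> R.
Proof.
move=> dd m_le; set m := (2 ^ d * k)%N in m_le.
have m'm : (2 ^ d' * k <= m)%N by rewrite leq_mul2r leq_exp2l // dd orbT.
have km : (k <= m)%N by rewrite -[X in (X <= _)%N]mul1n leq_mul2r expn_gt0 orbT.
apply: le_trans (_ : (2 ^ (4 * m))%:R * (2 * t)%:R <= _).
  rewrite -natrM ler_nat.
  have -> : (2 ^ (4 * m) * (2 * t) = 2 ^ m * (2 * 2 ^ m * (4 ^ m * t)))%N.
    have -> : (4 * m = m + m + (m + m))%N by lia.
    rewrite !expnD (_ : 4 ^ m = 2 ^ m * 2 ^ m)%N; [lia|by rewrite -expnMn].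
  by rewrite /cone_bound; do !(apply: leq_mul => //); rewrite leq_exp2l.
rewrite ler_wpM2r // natrX -powR_mulrn // ler_powR ?ler1n // natrM.
by rewrite -mulrA ler_wpM2l.
Qed.

End Asymptotics.

Unset Implicit Arguments.
Local Close Scope sesquilinear_scope.
Local Open Scope classical_set_scope.
Local Open Scope ring_scope.

Theorem corollary3p5 (R : realType)
    (haar : forall n : nat, probability (qstate R 'I_n) R)
    (haarP : forall n : nat, is_haar (haar n))
    (E : forall n : nat, ensemble R 'I_n) (eps : nat -> R)
    (eps_small : exp_small eps)
    (E_design : forall n : nat, approx_2design (haar n) (E n) (eps n))
    (d k : nat -> nat) (f : nat -> R)
    (f_littleo : f =o_\oo (fun n : nat => n%:R / log2 n%:R : R))
    (k_le : forall n : nat, (k n)%:R <= 2 ^- d n * f n) :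
  PRS_against_QNC haar E d k.
Proof.
move=> t c [a t_poly] _ _ depth_le b.
have [c0 c0_gt0 eps_le] := eps_small.
(* Capping the rate at 1 makes both 2^-n and, for large n, eps at most 2^(-g n). *)
pose g := Num.min c0 1.
have g0 : 0 < g by rewrite lt_min c0_gt0 ltr01.
have g1 : g <= 1 by rewrite ge_min lexx orbT.
have gc : g <= c0 by rewrite ge_min lexx.
(* With m <= g n / 16 the cone factor 2^(4 m) is at most 2^(g n / 4), which takes back only half of
   the exponent gained from s. *)
have f_le : (\forall n \near \oo, f n <= g / 16 * n%:R)%classic.
  by apply: littleo_div_log_le => //; rewrite divr_gt0.
(* Here 12 = 2 * 6 comes from the factors 2 t and 6 s below; n^a bounds t and n^b is the inverse of
   the target. *)
have poly_le : (\forall n \near \oo, (12 * n ^ (a + b))%:R <= 2 `^ (g / 4 * n%:R) :> R)%classic.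
  by apply: poly_le_powR; rewrite divr_gt0.
have n1_near : (\forall n \near \oo, (1 <= n)%N)%classic by exact: nbhs_infty_ge.
near=> n.
have n1 : (1 <= n)%N by near: n; exact: n1_near.
have tn : (t n <= n ^ a)%N by near: n; exact: t_poly.
have en : eps n <= 2 `^ (- (c0 * n%:R)) by near: n; exact: eps_le.
have fn : f n <= g / 16 * n%:R by near: n; exact: f_le.
have pn : (12 * n ^ (a + b))%:R <= 2 `^ (g / 4 * n%:R) :> R by near: n; exact: poly_le.
have N_eq : #|{: bits 'I_n}| = (2 ^ n)%N by rewrite card_bits card_ord.
have N_gt1 : (1 < #|{: bits 'I_n}|)%N by rewrite N_eq -{1}(expn0 2) ltn_exp2l.
(* Balances s against eta / s: as eta <= 5 s^2, the sum is at most 6 s. *)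
pose s : R := 2 `^ (- (g / 2 * n%:R)).
have s0 : 0 < s by exact: powR_gt0.
have ss : s * s = 2 `^ (- (g * n%:R)).
  rewrite -powRD; last by rewrite pnatr_eq0 implybT.
  by congr (2 `^ _); field.
have n0 : 0 <= n%:R :> R by [].
have eta_le : 4 / #|{: bits 'I_n}|%:R + eps n <= 5 * (s * s).
  rewrite (_ : 5 * (s * s) = 4 * (s * s) + s * s); last by ring.
  apply: lerD.
    rewrite ler_wpM2l // N_eq natrX -powR_mulrn // -powRN ss ler_powR ?ler1n //.
    by rewrite lerN2 ler_piMl.
  by apply: le_trans en _; rewrite ss ler_powR ?ler1n // lerN2 ler_wpM2r.
have m_le : (2 ^ d n * k n)%:R <= g / 16 * n%:R.
  apply: le_trans fn; rewrite natrM natrX.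
  by rewrite -ler_pdivlMl ?exprn_gt0.
rewrite ger0_norm; last first.
  by rewrite /Defs.total_variation mulr_ge0 ?invr_ge0 // sumr_ge0.
apply: le_trans (total_variation_le (haarP n) (E_design n) N_gt1 (c n) s0) _.
apply: le_trans (_ : 2 `^ (4 * (g / 16) * n%:R) * (2 * t n)%:R * (6 * s) <= _).
  apply: ler_pM => //.
  - rewrite addr_ge0 ?divr_ge0 ?addr_ge0 ?divr_ge0 // ?(ltW s0) //.
    exact: le_trans (trace_norm_ge0 _) (E_design n).
  - exact: cone_factor_le (depth_le n) m_le.
  - rewrite (_ : 6 * s = s + 5 * s); last by ring.
    by rewrite lerD2l ler_pdivrMr // -mulrA.
set Y := 2 `^ _ in pn; have Y0 : 0 < Y by exact: powR_gt0.
have YE : 2 `^ (4 * (g / 16) * n%:R) * s = Y^-1.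
  rewrite -powRD; last by rewrite pnatr_eq0 implybT.
  by rewrite -powRN; congr (2 `^ _); field.
rewrite (_ : _ * _ = (12 * t n)%:R / Y); last by rewrite -YE !natrM; ring.
rewrite ler_pdivrMr // ler_pdivlMl ?exprn_gt0 ?ltr0n //; apply: le_trans pn.
rewrite -natrX -natrM ler_nat expnD mulnCA leq_mul2l /= mulnC.
by rewrite leq_mul2r tn orbT.
Unshelve. all: by end_near. Qed.
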